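(* Let $A = C^*(x, y \mid x = x^*,\ y = y^*,\ x^2+y^2 = 1)$ be the universal unital $C^*$-algebra with the indicated generators and relations. Equip $A$ with the action $\alpha$ of $\mathbb{Z}/2\mathbb{Z}$ generated by the automorphism $x\mapsto -x$, $y\mapsto -y$, and let $\beta = \alpha$. Then there is an $(\alpha,\widetilde{\alpha})$-equivariant, unital $*$-homomorphism from $A$ to $J(A,\beta)$. Here $\alpha$ is free and the automorphism generating $\beta$ is connected within $\mathrm{Aut}(A)$ to the trivial automorphism; consequently, for commuting actions $\alpha,\beta$ of $\mathbb{Z}/k\mathbb{Z}$ on a unital $C^*$-algebra $A$ with $\alpha$ free, the condition that the individual automorphisms of $\beta$ are connected within $\mathrm{Aut}(A)$ to the trivial automorphism is insufficient to guarantee that there are no $(\alpha,\widetilde{\alpha})$-equivariant, unital $*$-homomorphisms from $A$ to $J(A,\beta)$.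
   Context: Continuous paths in $\mathrm{Aut}(A)$ are always continuous with respect to the pointwise norm topology; ''connected within $\mathrm{Aut}(A)$'' means connected by such a path. Let $k\ge 2$, let $\alpha$ and $\beta$ be commuting actions of $\mathbb{Z}/k\mathbb{Z}$ on a unital $C^*$-algebra $A$, and let $\omega = e^{2\pi i/k}$. The group $\Gamma=\mathbb{Z}/k\mathbb{Z}$ acting through $\beta$ is identified with the Pontryagin dual of the group $G=\mathbb{Z}/k\mathbb{Z}$ acting through $\alpha$. Freeness: for an action $\alpha$ of a finite abelian group $G$ on $A$ and a character $\gamma \in \widehat{G}$, let $A_\gamma = \{a \in A : \alpha_g(a) = \gamma(g)a \text{ for all } g \in G\}$. The action is free if $1 \in \overline{A_\gamma A_\gamma^*}$ for every $\gamma$, where $A_\gamma A_\gamma^*$ is the linear span of the products $ab^*$ with $a,b\in A_\gamma$. Crossed product: $A \rtimes_\beta \Gamma$ is generated by $A$ and $\Gamma$, where $\Gamma$ is a group of unitaries implementing $\beta$. Writing $\mu$ for the unitary corresponding to a generator, its elements are uniquely $\sum_{j=0}^{k-1} a_j\mu^j$ with $a_j \in A$. Both $A$ and $C^*(\Gamma)$ are regarded as unital subalgebras. Twisted join: $J(A,\beta) = \{f \in C([0,1], A\rtimes_\beta \Gamma) : f(0) \in C^*(\Gamma),\ f(1) \in A\}$. Action $\widetilde{\alpha}$: the action of $\mathbb{Z}/k\mathbb{Z}$ on $J(A,\beta)$ obtained by applying pointwise the action on $A\rtimes_\beta\Gamma$ generated by the automorphism $\sum_j a_j\mu^j \mapsto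 \sum_j \omega^j\alpha(a_j)\mu^j$, where $\alpha$ also denotes the automorphism generating the action $\alpha$. For $k=2$ this is $a_0+a_1\mu\mapsto \alpha(a_0)-\alpha(a_1)\mu$. A map $\phi$ is $(\sigma,\tau)$-equivariant if $\phi\circ\sigma_g = \tau_g\circ\phi$ for all group elements $g$. *)

(* Defs.v *)
From HB Require Import structures.
From mathcomp Require Import all_boot all_order all_algebra.
From mathcomp Require Import complex.
From mathcomp Require Import all_classical all_reals all_analysis.

Set Implicit Arguments.
Unset Strict Implicit.
Unset Printing Implicit Defensive.

Import Order.TTheory GRing.Theory Num.Theory.
Import numFieldNormedType.Exports.

Local Open Scope classical_set_scope.
Local Open Scope ring_scope.
Local Open Scope complex_scope.

HB.mixin Record hasStar (C : numClosedFieldType) A of GRing.Algebra C A := {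
  star : A -> A;
  starK : involutive star;
  starD : {morph star : a b / a + b};
  starZ : forall (c : C) (a : A), star (c *: a) = Num.conj c *: star a;
  starM : forall a b : A, star (a * b) = star b * star a
}.

#[short(type="starAlgType")]
HB.structure Definition StarAlgebra (C : numClosedFieldType) :=
  {A of hasStar C A & GRing.Algebra C A}.

(* A norm on a MathComp ring type cannot be declared through Num.NormedZmodule
   without the ring becoming a numDomainType, hence a separate operation; the
   library's topology comes back on the alias normed_space below. *)
HB.mixin Record hasCStarNorm (R : realType) A of StarAlgebra R[i] A := {
  cnorm : A -> R;
  cnormD : forall a b : A, cnorm (a + b) <= cnorm a + cnorm b;
  cnormZ : forall (c : R[i]) (a : A), cnorm (c *: a) = Normc.normc c * cnorm a;
  cnorm0_eq0 : forall a : A, cnorm a = 0 -> a = 0;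
  cnormM : forall a b : A, cnorm (a * b) <= cnorm a * cnorm b;
  cnorm_starM : forall a : A, cnorm (star a * a) = cnorm a ^+ 2
}.

#[short(type="preCStarAlgType")]
HB.structure Definition PreCStarAlgebra (R : realType) :=
  {A of hasCStarNorm R A & StarAlgebra R[i] A}.

(* The underlying normed space, with norm a |-> (cnorm a)%:C as for every
   normedModType over R[i]. *)
Definition normed_space (R : realType) (A : preCStarAlgType R) : Type := A.

Section NormedSpace.
Variables (R : realType) (A : preCStarAlgType R).

HB.instance Definition _ := GRing.Lmodule.copy (normed_space A) A.

Let norm (a : normed_space A) : R[i] := (cnorm (a : A))%:C.

Let normD (a b : normed_space A) : norm (a + b) <= norm a + norm b.
Proof. by rewrite /norm -rmorphD lecR; exact: cnormD. Qed.

Let normZ (c : R[i]) (a : normed_space A) : norm (c *: a) = `|c| * norm a.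
Proof. by rewrite /norm normc_def -rmorphM /= cnormZ; case: c. Qed.

Let norm0_eq0 (a : normed_space A) : norm a = 0 -> a = 0.
Proof. by case=> /cnorm0_eq0. Qed.

HB.instance Definition _ :=
  Lmodule_isNormed.Build R[i] (normed_space A) normD normZ norm0_eq0.

End NormedSpace.

HB.mixin Record isCStarComplete (R : realType) A of PreCStarAlgebra R A := {
  cstar_complete : forall F : set_system (normed_space A),
    ProperFilter F -> cauchy F -> cvg F
}.

(* Unital C*-algebras.  MathComp algebras satisfy 1 != 0, so the zero algebra
   is excluded. *)
#[short(type="cstarAlgType")]
HB.structure Definition CStarAlgebra (R : realType) :=
  {A of isCStarComplete R A & PreCStarAlgebra R A}.

HB.instance Definition _ (R : realType) (A : cstarAlgType R) :=
  Uniform_isComplete.Build (normed_space A) (@cstar_complete R A).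

Definition star_hom (C : numClosedFieldType) (A B : starAlgType C)
    (f : A -> B) : Prop :=
  [/\ linear f, monoid_morphism f & {morph f : a / star a}].

Definition star_aut (C : numClosedFieldType) (A : starAlgType C)
    (f : A -> A) : Prop := star_hom f /\ bijective f.

Section FunctionStarAlgebra.
Variables (T : pointedType) (C : numClosedFieldType) (B : starAlgType C).

Let fct_scalerAl (c : C) (f g : T -> B) : c *: (f * g) = (c *: f) * g.
Proof. by apply/funext => t; exact: scalerAl. Qed.

HB.instance Definition _ :=
  GRing.Lmodule_isLalgebra.Build C (T -> B) fct_scalerAl.

Let fct_scalerAr (c : C) (f g : T -> B) : c *: (f * g) = f * (c *: g).
Proof. by apply/funext => t; exact: scalerAr. Qed.

HB.instance Definition _ :=
  GRing.Lalgebra_isAlgebra.Build C (T -> B) fct_scalerAr.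

Let fct_star (f : T -> B) : T -> B := fun t => star (f t).

Let fct_starK : involutive fct_star.
Proof. by move=> f; apply/funext => t; exact: starK. Qed.

Let fct_starD : {morph fct_star : f g / f + g}.
Proof. by move=> f g; apply/funext => t; exact: starD. Qed.

Let fct_starZ (c : C) f : fct_star (c *: f) = Num.conj c *: fct_star f.
Proof. by apply/funext => t; exact: starZ. Qed.

Let fct_starM f g : fct_star (f * g) = fct_star g * fct_star f.
Proof. by apply/funext => t; exact: starM. Qed.

HB.instance Definition _ :=
  hasStar.Build C (T -> B) fct_starK fct_starD fct_starZ fct_starM.

End FunctionStarAlgebra.

Section UnitInterval.
Variable R : realType.

Definition unit_interval : Type := set_type `[0 : R, 1]%classic.

HB.instance Definition _ := Topological.copy unit_interval
  (set_type `[0 : R, 1]%classic).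

Let zero_in01 : (0 : R) \in `[0 : R, 1]%classic.
Proof. by rewrite inE /= in_itv /= lexx ler01. Qed.

Let one_in01 : (1 : R) \in `[0 : R, 1]%classic.
Proof. by rewrite inE /= in_itv /= lexx ler01. Qed.

Definition itv0 : unit_interval := exist _ 0 zero_in01.
Definition itv1 : unit_interval := exist _ 1 one_in01.

HB.instance Definition _ := isPointed.Build unit_interval itv0.

End UnitInterval.

Section Actions.
Variables (R : realType) (A : cstarAlgType R).

Definition is_action (G : finZmodType) (alpha : G -> A -> A) : Prop :=
  [/\ forall g, star_aut (alpha g), alpha 0 =1 id &
      forall g h, alpha (g + h) =1 alpha g \o alpha h].

Definition commuting (G : finZmodType) (alpha beta : G -> A -> A) : Prop :=
  forall g h, alpha g \o beta h =1 beta h \o alpha g.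

Definition is_character (G : finZmodType) (gamma : G -> R[i]) : Prop :=
  (forall g, `|gamma g| = 1) /\
  (forall g h, gamma (g + h) = gamma g * gamma h).

Definition spectral_subspace (G : finZmodType) (alpha : G -> A -> A)
    (gamma : G -> R[i]) : set A :=
  [set a | forall g, alpha g a = gamma g *: a].

Definition span_mul_star (V : set A) : set A :=
  [set z | exists (n : nat) (c : 'I_n -> R[i]) (a b : 'I_n -> A),
     [/\ forall i, V (a i), forall i, V (b i) &
         z = \sum_(i < n) c i *: (a i * star (b i))]].

Definition free_action (G : finZmodType) (alpha : G -> A -> A) : Prop :=
  forall gamma, is_character gamma ->
    closure (span_mul_star (spectral_subspace alpha gamma)
             : set (normed_space A)) (1 : A).

Definition connected_to_id (sigma : A -> A) : Prop :=
  exists p : unit_interval R -> {ptws normed_space A -> normed_space A},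
    [/\ continuous p, forall t, star_aut (p t : A -> A),
        p (itv0 R) = sigma & p (itv1 R) = id].

Definition circle_relations (B : cstarAlgType R) (u v : B) : Prop :=
  [/\ star u = u, star v = v & u ^+ 2 + v ^+ 2 = 1].

Definition universal_circle (x y : A) : Prop :=
  circle_relations x y /\
  forall (B : cstarAlgType R) (u v : B), circle_relations u v ->
    exists! phi : A -> B, [/\ star_hom phi, phi x = u & phi y = v].

End Actions.

Definition exp_2pi_over (R : realType) (k : nat) : R[i] :=
  cos (2 * pi / k%:R) +i* sin (2 * pi / k%:R).

(* The crossed product of A by beta, with mu the unitary of the generator 1 of
   'Z_k; the fields determine it up to *-isomorphism (the C*-norm of a
   *-algebra complete for it is unique).  coef b j is the coefficient a_j of
   b = \sum_j a_j mu^j. *)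
Record crossed_product (R : realType) (A : cstarAlgType R) (k : nat)
    (beta : 'Z_k -> A -> A) := CrossedProduct {
  cp_alg :> cstarAlgType R;
  cp_inj : A -> cp_alg;
  cp_mu : cp_alg;
  cp_coef : cp_alg -> 'I_k -> A;
  cp_inj_hom : star_hom cp_inj;
  cp_mu_unitary : star cp_mu * cp_mu = 1 /\ cp_mu * star cp_mu = 1;
  cp_mu_order : cp_mu ^+ k = 1;
  cp_covariant : forall a, cp_mu * cp_inj a * star cp_mu = cp_inj (beta 1 a);
  cp_expand : forall b, b = \sum_(j < k) cp_inj (cp_coef b j) * cp_mu ^+ j;
  cp_unique : forall a : 'I_k -> A,
    cp_coef (\sum_(j < k) cp_inj (a j) * cp_mu ^+ j) =1 a
}.

Section TwistedJoin.
Variables (R : realType) (A : cstarAlgType R) (k : nat).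
Variables (beta : 'Z_k -> A -> A) (X : crossed_product beta).

(* The group being finite, its C*-algebra is the span of the powers of mu. *)
Definition group_cstar : set X :=
  [set b | exists c : 'I_k -> R[i], b = \sum_(j < k) c j *: cp_mu X ^+ j].

Definition twisted_join : set (unit_interval R -> X) :=
  [set f | [/\ continuous (f : unit_interval R -> normed_space X),
               group_cstar (f (itv0 R)) & range (cp_inj X) (f (itv1 R))]].

Definition twisted_aut (alpha : 'Z_k -> A -> A) (b : X) : X :=
  \sum_(j < k) exp_2pi_over R k ^+ j *:
    (cp_inj X (alpha 1 (cp_coef b j)) * cp_mu X ^+ j).

(* Defined on all functions from [0, 1] to X; the action on the twisted join is
   its restriction. *)
Definition twisted_action (alpha : 'Z_k -> A -> A) (g : 'Z_k)
    (f : unit_interval R -> X) : unit_interval R -> X :=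
  fun t => iter g (twisted_aut alpha) (f t).

End TwistedJoin.

Definition equivariant (G S T : Type) (sigma : G -> S -> S) (tau : G -> T -> T)
    (phi : S -> T) : Prop :=
  forall g, phi \o sigma g = tau g \o phi.

(* The *-algebra operations on the twisted join are the pointwise ones, so a
   *-homomorphism to it is one to the functions [0, 1] -> X landing in it. *)
Definition has_equivariant_hom_to_join (R : realType) (A : cstarAlgType R)
    (k : nat) (alpha beta : 'Z_k -> A -> A) (X : crossed_product beta) : Prop :=
  exists phi : A -> (unit_interval R -> X),
    [/\ star_hom phi, forall a, twisted_join (phi a) &
        equivariant alpha (twisted_action alpha) phi].

(* Main.v *)
From HB Require Import structures.
Require Import Defs.
From mathcomp Require Import all_boot all_order all_algebra.
From mathcomp Require Import complex.
From mathcomp Require Import all_classical all_reals all_analysis.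
From mathcomp Require Import ring lra.

(** The idea is the following formula. Suppose that [x] and [y] satisfy the circle
    relations, and that a self-adjoint unitary [mu] anticommutes with both of
    them. If [s^2 + c^2 = 1], then
<<
      u = s x + c mu,    v = s y
>>
    satisfy the circle relations again, since [x mu + mu x = 0] removes the mixed
    terms of [u^2] ([circle_relations_join]). In the crossed product by
    [beta = alpha] the canonical unitary is such a [mu]. Letting [(s, c)] run from
    [(0, 1)] to [(1, 0)] gives a path of pairs from [(mu, 0)], in the group
    algebra, to [(x, y)], in [A]; the twisted automorphism changes the signs of
    [x], [y] and [mu], hence of [u] and [v]. The universal property turns this
    path into the equivariant homomorphism ([universal_join]). The antipodal
    automorphism is connected to the identity by rotating [(x, y)] through half a
    turn, because the circle relations are rotation invariant
    ([circle_relations_rot], [antipode_connected]). The action is free because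
    [x x^* + y y^* = 1] with [x] and [y] odd ([iter_action_free]).

    Homomorphisms are not shown to be continuous; instead the universal property
    is applied with target the C*-algebra of continuous paths, and homomorphisms
    are compared by its uniqueness part.

    The second half needs an algebra with these properties and its crossed
    product. Rather than the universal algebra, a smaller one is used, for which
    the crossed product is visible. Self-adjoint traceless 2 x 2 matrices form a
    Euclidean 3-space in which orthogonal vectors anticommute, so that every pair
    [(u, v)] of them has a unit vector [m] anticommuting with both
    ([exists_anticommuting_unit]). Let [A] be the closed *-algebra generated by
    the coordinates [u] and [v], as functions on the set of such pairs satisfying
    the circle relations, and let [X] be the set of functions
    [a0(u, v) + a1(u, v) m] on the set of triples [(u, v, m)]. Conjugation by [m]
    is the antipodal map ([spin_covariant]) and [m |-> - m] separates [a0] from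
    [a1] ([join_lim]), so that [X] is the crossed product. All maps are now
    substitutions: [a(u, v) |-> a(s u + c m, s v)] is the homomorphism into the
    join, and [(u, v, m) |-> (- u, - v, - m)] the twisted automorphism. That these
    substitutions preserve the algebras, and depend continuously on the
    parameter, is verified on the generators ([transport_all]). *)

Set Implicit Arguments.
Unset Strict Implicit.
Unset Printing Implicit Defensive.

Import Order.TTheory GRing.Theory Num.Theory.
Import numFieldNormedType.Exports.

Local Open Scope classical_set_scope.
Local Open Scope ring_scope.
Local Open Scope complex_scope.

(** * Norms *)

Lemma normc_ge0 (R : realType) (c : R[i]) : 0 <= Normc.normc c.
Proof. by case: c => x y; exact: sqrtr_ge0. Qed.

Lemma normcE (R : realType) (c : R[i]) : `|c| = (Normc.normc c)%:C.
Proof. by rewrite normc_def; case: c. Qed.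

Lemma normc_real (R : realType) (r : R) : Normc.normc r%:C = `|r|.
Proof. by rewrite /= expr0n addr0 sqrtr_sqr. Qed.

Lemma normc2V (R : realType) : Normc.normc (2^-1 : R[i]) = 2^-1.
Proof.
rewrite -[2 : R[i]](rmorph_nat (real_complex R)) -fmorphV normc_real.
by rewrite ger0_norm ?invr_ge0.
Qed.

(** The reverse inequality is the assumed one, applied to [c *: a] and the
    inverse of [c]. *)
Lemma homogeneous_of_le (R : realType) (E : lmodType R[i]) (N : E -> R) :
  (forall a, 0 <= N a) -> (forall c a, N (c *: a) <= Normc.normc c * N a) ->
  forall c a, N (c *: a) = Normc.normc c * N a.
Proof.
move=> N0 Nle c a; apply/eqP; rewrite eq_le Nle /=.
have [->|c0] := eqVneq c 0; first by rewrite Normc.normc0 mul0r.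
have nc0 : 0 < Normc.normc c.
  rewrite lt_neqAle normc_ge0 andbT eq_sym.
  by apply: contra c0 => /eqP/Normc.eq0_normc ->.
by rewrite -ler_pdivlMl // -[X in N X](scalerK c0) -(Normc.normcV c) Nle.
Qed.

Section NormFacts.
Variables (R : realType) (A : preCStarAlgType R).
Implicit Types a b : A.

Lemma cnorm0 : cnorm (0 : A) = 0.
Proof. by rewrite -(scale0r 0) cnormZ Normc.normc0 mul0r. Qed.

Lemma cnormN a : cnorm (- a) = cnorm a.
Proof. by rewrite -scaleN1r cnormZ normcN Normc.normc1 mul1r. Qed.

Lemma cnormBC a b : cnorm (a - b) = cnorm (b - a).
Proof. by rewrite -cnormN opprB. Qed.

Lemma cnorm_ge0 a : 0 <= cnorm a.
Proof. by have := cnormD a (- a); rewrite subrr cnorm0 cnormN; lra. Qed.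

Lemma cnorm_triangle a b c : cnorm (a - c) <= cnorm (a - b) + cnorm (b - c).
Proof. by rewrite -{1}(subrK b a) -addrA cnormD. Qed.

Lemma cnormB a b : cnorm (a - b) <= cnorm a + cnorm b.
Proof. by rewrite -(cnormN b) cnormD. Qed.

(** The C*-identity and submultiplicativity give [cnorm a <= cnorm (star a)];
    the involution gives the converse. *)
Lemma cnorm_star a : cnorm (star a) = cnorm a.
Proof.
have le b : cnorm b <= cnorm (star b).
  have := cnorm_ge0 b; rewrite le_eqVlt => /predU1P[<-|b0]; first exact: cnorm_ge0.
  by rewrite -(ler_pM2r b0) -expr2 -cnorm_starM cnormM.
by apply/eqP; rewrite eq_le le andbT -{2}(starK a) le.
Qed.

Lemma cnorm1 : cnorm (1 : A) = 1.
Proof.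
have star1 : star (1 : A) = 1 by rewrite -[LHS]mul1r -{1}(starK 1) -starM mul1r starK.
have /eqP := cnorm_starM (1 : A); rewrite star1 mul1r expr2.
rewrite -subr_eq0 -{1}(mulr1 (cnorm 1)) -mulrBr mulf_eq0 => /orP[/eqP/cnorm0_eq0/eqP|].
  by rewrite oner_eq0.
by rewrite subr_eq0 => /eqP.
Qed.

Lemma le0_cnorm_eq0 a : (forall e, 0 < e -> cnorm a <= e) -> a = 0.
Proof.
move=> h; apply: cnorm0_eq0; apply/eqP; rewrite eq_le cnorm_ge0 andbT.
by apply/ler_addgt0Pr => e e0; rewrite add0r h.
Qed.

Lemma cnorm_approx_eq a b : (forall e, 0 < e -> cnorm (a - b) <= e) -> a = b.
Proof. by move=> /le0_cnorm_eq0/eqP; rewrite subr_eq0 => /eqP. Qed.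

Definition cnorm_cauchy (u : nat -> A) := forall e : R, 0 < e ->
  exists N, forall m n, (N <= m)%N -> (N <= n)%N -> cnorm (u m - u n) <= e.

Definition cnorm_lim (u : nat -> A) (a : A) := forall e : R, 0 < e ->
  exists N, forall n, (N <= n)%N -> cnorm (u n - a) <= e.

Lemma normed_spaceE (a : normed_space A) : `|a| = (cnorm (a : A))%:C.
Proof. by []. Qed.

Lemma normed_space_ballE (a b : normed_space A) (e : R) :
  ball a e%:C b <-> cnorm ((a : A) - (b : A)) < e.
Proof. by rewrite -ball_normE /ball_/= normed_spaceE ltcR. Qed.

Lemma complexR_gt0 (e : R[i]) : 0 < e -> 0 < complex.Re e /\ e = (complex.Re e)%:C.
Proof.
move=> e0; have eE : e = (complex.Re e)%:C by rewrite RRe_real ?gtr0_real.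
by split=> //; rewrite -ltcR -eE.
Qed.

(** Completeness is assumed for Cauchy filters, but all completeness proofs below
    are about sequences: the centres of balls of radius [1 / n.+1] belonging to
    the filter form a Cauchy sequence with the same limit. *)
Lemma cstar_complete_of_seq :
  (forall u, cnorm_cauchy u -> exists a, cnorm_lim u a) ->
  forall F : set_system (normed_space A), ProperFilter F -> cauchy F -> cvg F.
Proof.
move=> hA F PF /cauchyP cF.
have pos n : 0 < (n.+1%:R^-1 : R) by rewrite invr_gt0.
have /choice[u uF] n : exists x : normed_space A, F (ball x (n.+1%:R^-1 : R)%:C).
  by apply: cF; rewrite ltcR.
have small (e : R) : 0 < e -> exists N, forall n, (N <= n)%N -> n.+1%:R^-1 <= e.
  move=> e0; exists (Num.trunc e^-1) => n Nn.
  rewrite -[leRHS]invrK lef_pV2 ?posrE ?invr_gt0 //.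
  by apply: (le_trans (ltW (truncnS_gt _))); rewrite ler_nat.
have ucau : cnorm_cauchy u.
  move=> e e0; have [N hN] := small (e / 2) (divr_gt0 e0 (ltr0Sn _ 1)).
  exists N => m n Nm Nn.
  have [z [/normed_space_ballE zm /normed_space_ballE zn]] :=
    @filter_ex _ F PF _ (@filterI _ F PF _ _ (uF m) (uF n)).
  apply: (le_trans (cnorm_triangle _ z _)); rewrite (cnormBC z).
  by apply: (le_trans (lerD (ltW zm) (ltW zn))); rewrite (splitr e) lerD ?hN.
have [a ua] := hA u ucau.
apply/cvg_ex; exists (a : normed_space A); apply/cvgrPdist_lt => eps /complexR_gt0[e0 ->].
move: (complex.Re eps) e0 => e e0.
have [N hN] := small (e / 2) (divr_gt0 e0 (ltr0Sn _ 1)).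
have e40 : 0 < e / 4 by lra.
have [N' hN'] := ua _ e40.
have [N'' hN''] := small (e / 4) e40.
pose n := maxn N' N''.
apply: (@filterS _ F PF _ _ _ (uF n)) => z /normed_space_ballE zn; rewrite normed_spaceE ltcR.
apply: (le_lt_trans (cnorm_triangle _ (u n) _)); rewrite (cnormBC a).
apply: (le_lt_trans (lerD (hN' n (leq_maxl _ _)) (ltW zn))).
by move: (hN'' n (leq_maxr _ _)); set x := (_^-1 : R) => ?; lra.
Qed.

End NormFacts.

Lemma seq_of_cstar_complete (R : realType) (A : cstarAlgType R) (u : nat -> A) :
  cnorm_cauchy u -> exists a, cnorm_lim u a.
Proof.
move=> cu.
have [a /cvgrPdist_lt ua] :
    exists a : normed_space A, (u : nat -> normed_space A) @ \oo --> a.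
  apply/cvg_ex; apply: cstar_complete; apply/cauchyP => eps /complexR_gt0[e0 ->].
  move: (complex.Re eps) e0 => e e0.
  have [N hN] := cu (e / 2) (divr_gt0 e0 (ltr0Sn _ 1)).
  exists (u N); exists N => // n /= Nn; apply/normed_space_ballE.
  by apply: (le_lt_trans (hN N n (leqnn _) Nn)); lra.
exists a => e e0; have e0C : 0 < e%:C by rewrite ltcR.
have [N _ hN] := ua _ e0C.
by exists N => n Nn; have := hN n Nn; rewrite /= normed_spaceE ltcR cnormBC => /ltW.
Qed.

(** * Closed *-algebras of bounded functions *)

Section SupNorm.
Variables (R : realType) (T : pointedType) (B : cstarAlgType R).
Implicit Types f g : T -> B.

Definition sup_norm f : R := sup (range (fun t => cnorm (f t))).

Lemma sup_norm_le f M : (forall t, cnorm (f t) <= M) -> sup_norm f <= M.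
Proof.
move=> fM; apply: ge_sup; first by exists (cnorm (f point)); exists point.
by move=> _ [t _ <-].
Qed.

Definition bounded_fct f := exists M, forall t, cnorm (f t) <= M.

Lemma le_sup_norm f t : bounded_fct f -> cnorm (f t) <= sup_norm f.
Proof.
move=> [M fM]; apply: ub_le_sup; last by exists t.
by exists M => _ [s _ <-].
Qed.

Lemma bounded_lin (c : R[i]) f g :
  bounded_fct f -> bounded_fct g -> bounded_fct (c *: f + g).
Proof.
move=> [M fM] [N gN]; exists (Normc.normc c * M + N) => t.
apply: le_trans (cnormD _ _) _.
by rewrite lerD // cnormZ ler_wpM2l ?normc_ge0.
Qed.

Lemma bounded_mul f g : bounded_fct f -> bounded_fct g -> bounded_fct (f * g).
Proof.
move=> [M fM] [N gN]; exists (M * N) => t; apply: le_trans (cnormM _ _) _.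
by rewrite ler_pM ?cnorm_ge0.
Qed.

Lemma bounded_star f : bounded_fct f -> bounded_fct (star f).
Proof. by move=> [M fM]; exists M => t; rewrite [leLHS]cnorm_star. Qed.

Lemma bounded_one : bounded_fct (1 : T -> B).
Proof. by exists (cnorm (1 : B)). Qed.

Lemma bounded_lim f :
  (forall e, 0 < e -> exists2 g, bounded_fct g & forall t, cnorm (f t - g t) <= e) ->
  bounded_fct f.
Proof.
move=> /(_ 1 ltr01)[g [M gM] fg]; exists (1 + M) => t.
by rewrite -[f t](subrK (g t)); apply: le_trans (cnormD _ _) _; rewrite lerD.
Qed.

End SupNorm.

(** Such a set of functions is a C*-algebra for the supremum norm. Paths in a
    C*-algebra, the concrete algebra of the counterexample and its crossed
    product are all of this kind. Closedness in the supremum norm is stated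
    through uniform approximation. *)
Record fun_cstar (R : realType) (T : pointedType) (B : cstarAlgType R) := FunCStar {
  fc_set :> (T -> B) -> Prop;
  fc_bounded : forall f, fc_set f -> bounded_fct f;
  fc_one : fc_set 1;
  fc_lin : forall (c : R[i]) f g, fc_set f -> fc_set g -> fc_set (c *: f + g);
  fc_mul : forall f g, fc_set f -> fc_set g -> fc_set (f * g);
  fc_star : forall f, fc_set f -> fc_set (star f);
  fc_lim : forall f,
    (forall e, 0 < e -> exists2 g, fc_set g & forall t, cnorm (f t - g t) <= e) ->
    fc_set f
}.

Section FunctionCStarAlgebra.
Variables (R : realType) (T : pointedType) (B : cstarAlgType R).
Variable S : fun_cstar T B.

Definition fc_mem : {pred T -> B} := fun f => `[< S f >].

Lemma fc_subalg : GRing.subsemialg_closed fc_mem.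
Proof.
apply: GRing.subalg_closed_semi; split.
- by apply/asboolP; exact: fc_one.
- by move=> c f g /asboolP Sf /asboolP Sg; apply/asboolP; exact: fc_lin.
- by move=> f g /asboolP Sf /asboolP Sg; apply/asboolP; exact: fc_mul.
Qed.

HB.instance Definition _ :=
  GRing.isSubalgClosed.Build R[i] (T -> B) fc_mem fc_subalg.

Record fc_alg := FcAlg { fc_val :> T -> B; fc_valP : fc_val \in fc_mem }.

HB.instance Definition _ := [isSub for fc_val].
HB.instance Definition _ := [Choice of fc_alg by <:].
HB.instance Definition _ := [SubChoice_isSubAlgebra of fc_alg by <:].

Definition to_fc f (Sf : S f) : fc_alg := FcAlg (asboolT Sf).

Lemma fc_inP (a : fc_alg) : S (fc_val a).
Proof. exact/asboolP/fc_valP. Qed.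

Lemma fc_ext (a b : fc_alg) : fc_val a =1 fc_val b -> a = b.
Proof. by move=> ab; apply/val_inj/funext. Qed.

Lemma fc_evalD (a b : fc_alg) t : fc_val (a + b) t = fc_val a t + fc_val b t.
Proof. by []. Qed.

Lemma fc_evalN (a : fc_alg) t : fc_val (- a) t = - fc_val a t.
Proof. by []. Qed.

Lemma fc_evalZ (c : R[i]) (a : fc_alg) t : fc_val (c *: a) t = c *: fc_val a t.
Proof. by []. Qed.

Lemma fc_evalM (a b : fc_alg) t : fc_val (a * b) t = fc_val a t * fc_val b t.
Proof. by []. Qed.

Lemma fc_eval1 t : fc_val (1 : fc_alg) t = 1.
Proof. by []. Qed.

Definition fc_algstar (a : fc_alg) : fc_alg := to_fc (fc_star (fc_inP a)).

Let fc_algstarK : involutive fc_algstar.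
Proof. by move=> a; apply: fc_ext => t; exact: starK. Qed.

Let fc_algstarD : {morph fc_algstar : a b / a + b}.
Proof. by move=> a b; apply: fc_ext => t; rewrite !fc_evalD [LHS]starD. Qed.

Let fc_algstarZ (c : R[i]) a : fc_algstar (c *: a) = Num.conj c *: fc_algstar a.
Proof. by apply: fc_ext => t; rewrite fc_evalZ -starZ -fc_evalZ. Qed.

Let fc_algstarM a b : fc_algstar (a * b) = fc_algstar b * fc_algstar a.
Proof. by apply: fc_ext => t; rewrite fc_evalM -starM -fc_evalM. Qed.

HB.instance Definition _ :=
  hasStar.Build R[i] fc_alg fc_algstarK fc_algstarD fc_algstarZ fc_algstarM.

Definition fc_norm (a : fc_alg) : R := sup_norm (fc_val a).

Lemma fc_norm_ub (a : fc_alg) t : cnorm (fc_val a t) <= fc_norm a.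
Proof. exact/le_sup_norm/fc_bounded/fc_inP. Qed.

Lemma fc_norm_ge0 (a : fc_alg) : 0 <= fc_norm a.
Proof. exact: le_trans (cnorm_ge0 _) (fc_norm_ub a point). Qed.

Let fc_normD a b : fc_norm (a + b) <= fc_norm a + fc_norm b.
Proof.
apply: sup_norm_le => t; rewrite fc_evalD; apply: le_trans (cnormD _ _) _.
by rewrite lerD ?fc_norm_ub.
Qed.

Let fc_normZ_le (c : R[i]) a : fc_norm (c *: a) <= Normc.normc c * fc_norm a.
Proof.
by apply: sup_norm_le => t; rewrite fc_evalZ cnormZ ler_wpM2l ?normc_ge0 ?fc_norm_ub.
Qed.

Let fc_normZ (c : R[i]) a : fc_norm (c *: a) = Normc.normc c * fc_norm a.
Proof. exact: (homogeneous_of_le fc_norm_ge0 fc_normZ_le c a). Qed.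

Let fc_norm0_eq0 a : fc_norm a = 0 -> a = 0.
Proof.
move=> a0; apply: fc_ext => t; apply: cnorm0_eq0.
by apply/eqP; rewrite eq_le cnorm_ge0 andbT -a0 fc_norm_ub.
Qed.

Let fc_normM a b : fc_norm (a * b) <= fc_norm a * fc_norm b.
Proof.
apply: sup_norm_le => t; rewrite fc_evalM; apply: le_trans (cnormM _ _) _.
by rewrite ler_pM ?cnorm_ge0 ?fc_norm_ub.
Qed.

Let fc_norm_starM a : fc_norm (star a * a) = fc_norm a ^+ 2.
Proof.
apply/eqP; rewrite eq_le; apply/andP; split.
  apply: le_trans (fc_normM _ _) _; rewrite expr2 ler_wpM2r ?fc_norm_ge0 //.
  by apply: sup_norm_le => t; rewrite [leLHS]cnorm_star fc_norm_ub.
rewrite -[leRHS]sqr_sqrtr ?fc_norm_ge0 // ler_sqr ?nnegrE ?fc_norm_ge0 ?sqrtr_ge0 //.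
apply: sup_norm_le => t; rewrite -[leLHS]ger0_norm ?cnorm_ge0 // -sqrtr_sqr.
rewrite ler_sqrt ?fc_norm_ge0 //.
by rewrite -cnorm_starM; exact: (fc_norm_ub (star a * a) t).
Qed.

HB.instance Definition _ := hasCStarNorm.Build R fc_alg
  fc_normD fc_normZ fc_norm0_eq0 fc_normM fc_norm_starM.

Let fc_seq_complete (u : nat -> fc_alg) :
  cnorm_cauchy u -> exists a, cnorm_lim u a.
Proof.
move=> cu.
have /choice[f fu] t : exists b, cnorm_lim (fun n => fc_val (u n) t) b.
  apply: seq_of_cstar_complete => e e0; have [N hN] := cu e e0.
  by exists N => m n Nm Nn; exact: le_trans (fc_norm_ub (u m - u n) t) (hN _ _ Nm Nn).
(* A uniform Cauchy estimate passes to the pointwise limit. *)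
have unif e : 0 < e -> exists N, forall n, (N <= n)%N ->
    forall t, cnorm (fc_val (u n) t - f t) <= e.
  move=> e0; have [N hN] := cu _ e0; exists N => n Nn t.
  apply/ler_addgt0Pr => d d0; have [M hM] := fu t d d0.
  apply: le_trans (cnorm_triangle _ (fc_val (u (maxn N M)) t) _) _.
  apply: lerD; last by apply: hM; exact: leq_maxr.
  by apply: le_trans (fc_norm_ub (u n - u _) t) _; exact/hN/leq_maxl.
have Sf : S f.
  apply: fc_lim => e e0; have [N hN] := unif e e0.
  exists (u N); first exact: fc_inP.
  by move=> t; rewrite cnormBC hN.
exists (to_fc Sf) => e e0; have [N hN] := unif e e0; exists N => n Nn.
by apply: sup_norm_le => t; exact: hN.
Qed.

HB.instance Definition _ :=
  isCStarComplete.Build R fc_alg (cstar_complete_of_seq fc_seq_complete).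

Lemma fc_eval_hom t : star_hom (fun a : fc_alg => fc_val a t).
Proof. by split=> //; split. Qed.

End FunctionCStarAlgebra.

(** * Matrices with the operator norm *)

Section HermitianSpace.
Variables (R : realType) (n : nat).
Local Notation C := R[i].
Implicit Types u v : 'rV[C]_n.

Lemma hnorm_exists : {h : 'rV[C]_n -> R | forall v, (h v)%:C = sqrtC (dotmx v v)}.
Proof.
exists (fun v => complex.Re (sqrtC (dotmx v v))) => v.
by rewrite RRe_real // ger0_real // sqrtC_ge0 dnorm_ge0.
Qed.

(* Only the characteristic property of the length is made available; its
   unfolding would lead to complex square roots. *)
Definition hnorm : 'rV[C]_n -> R := sval hnorm_exists.

Lemma hnormE v : (hnorm v)%:C = sqrtC (dotmx v v).
Proof. exact: (svalP hnorm_exists). Qed.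

Lemma hnorm_ge0 v : 0 <= hnorm v.
Proof. by rewrite -lecR hnormE sqrtC_ge0 dnorm_ge0. Qed.

Lemma hnorm_sqr v : (hnorm v ^+ 2)%:C = dotmx v v.
Proof. by rewrite rmorphXn /= hnormE sqrtCK. Qed.

Lemma hnormD u v : hnorm (u + v) <= hnorm u + hnorm v.
Proof. by rewrite -lecR rmorphD /= !hnormE; exact: (triangle_lerif (@dotmx _ n) u v). Qed.

Lemma hnormZ c v : hnorm (c *: v) = Normc.normc c * hnorm v.
Proof.
apply/complexI; rewrite rmorphM /= !hnormE (dnormZ (@dotmx _ n)).
by rewrite sqrtCM ?nnegrE ?exprn_ge0 ?dnorm_ge0 // sqrCK // normcE.
Qed.

Lemma hnorm_eq0 v : hnorm v = 0 -> v = 0.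
Proof.
move=> v0; have /eqP := hnorm_sqr v.
by rewrite v0 expr0n /= eq_sym (dnorm_eq0 (@dotmx _ n)) => /eqP.
Qed.

Lemma hnorm_dot u v : Normc.normc (dotmx u v) <= hnorm u * hnorm v.
Proof.
by rewrite -lecR rmorphM /= !hnormE -normcE; exact: (CauchySchwarz_sqrt (@dotmx _ n) u v).
Qed.

Lemma dotmx_delta v i : dotmx v (delta_mx 0 i) = v 0 i.
Proof.
rewrite dotmxE mxE (bigD1 i) //= big1 => [|j ji]; rewrite !mxE ?eqxx.
  by rewrite conjC1 mulr1 addr0.
by rewrite (negPf ji) conjC0 mulr0.
Qed.

Lemma hnorm_delta i : hnorm (delta_mx 0 i) = 1.
Proof. by apply/complexI; rewrite hnormE dotmx_delta mxE !eqxx sqrtC1. Qed.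

Lemma normc_coord_le v i : Normc.normc (v 0 i) <= hnorm v.
Proof. by have := hnorm_dot v (delta_mx 0 i); rewrite hnorm_delta mulr1 dotmx_delta. Qed.

Lemma hnorm0 : hnorm 0 = 0.
Proof. by rewrite -(scale0r 0) hnormZ Normc.normc0 mul0r. Qed.

Lemma hnorm_sum (I : finType) (F : I -> 'rV[C]_n) :
  hnorm (\sum_i F i) <= \sum_i hnorm (F i).
Proof.
elim/big_ind2: _ => [|v r w s vr ws|//]; first by rewrite hnorm0.
by apply: le_trans (hnormD _ _) _; rewrite lerD.
Qed.

Lemma hnorm_le_coord v : hnorm v <= \sum_i Normc.normc (v 0 i).
Proof.
rewrite {1}(row_sum_delta v); apply: le_trans (hnorm_sum _) _.
by apply: ler_sum => i _; rewrite hnormZ hnorm_delta mulr1.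
Qed.

End HermitianSpace.

Section OperatorNorm.
Variables (R : realType) (n : nat).
Local Notation C := R[i].
Implicit Types a b : 'M[C]_n.
Implicit Types u v : 'rV[C]_n.

Definition entry_sum a : R := \sum_i \sum_j Normc.normc (a i j).

Lemma entry_sum_bound a v : hnorm (v *m a) <= entry_sum a * hnorm v.
Proof.
rewrite mulmx_sum_row; apply: le_trans (hnorm_sum _) _; rewrite mulr_suml.
apply: ler_sum => i _; rewrite hnormZ mulrC.
apply: ler_pM; rewrite ?hnorm_ge0 ?normc_ge0 ?normc_coord_le //.
apply: le_trans (hnorm_le_coord _) _.
by apply: ler_sum => j _; rewrite mxE.
Qed.

Lemma entry_sum_ge0 a : 0 <= entry_sum a.
Proof. by do 2!(apply: sumr_ge0 => ? _); exact: normc_ge0. Qed.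

(* Matrices act on row vectors from the right; the two properties say that [N a]
   is the supremum of the lengths of the images of the unit ball. *)
Lemma opnorm_exists : {N : 'M[C]_n -> R | forall a,
  (forall M, 0 <= M -> (forall v, hnorm (v *m a) <= M * hnorm v) -> N a <= M) /\
  (forall v, hnorm v <= 1 -> hnorm (v *m a) <= N a)}.
Proof.
exists (fun a => sup [set hnorm (v *m a) | v in [set v | hnorm v <= 1]]) => a.
split=> [M M0 aM|v v1].
  apply: ge_sup; first by exists (hnorm (0 *m a)); exists 0 => //=; rewrite hnorm0.
  move=> _ [v /= v1 <-]; apply: le_trans (aM v) _.
  by rewrite -[leRHS]mulr1 ler_wpM2l.
apply: ub_le_sup; last by exists v.
exists (entry_sum a) => _ [w /= w1 <-]; apply: le_trans (entry_sum_bound _ _) _.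
by rewrite -[leRHS]mulr1 ler_wpM2l ?entry_sum_ge0.
Qed.

Definition opnorm : 'M[C]_n -> R := sval opnorm_exists.

Lemma opnorm_le a M :
  0 <= M -> (forall v, hnorm (v *m a) <= M * hnorm v) -> opnorm a <= M.
Proof. exact: (svalP opnorm_exists a).1. Qed.

Let opnorm_ub1 a v : hnorm v <= 1 -> hnorm (v *m a) <= opnorm a.
Proof. exact: (svalP opnorm_exists a).2. Qed.

Lemma opnorm_ub a v : hnorm (v *m a) <= opnorm a * hnorm v.
Proof.
have [/hnorm_eq0 ->|v0] := eqVneq (hnorm v) 0; first by rewrite mul0mx hnorm0 mulr0.
have vp : 0 < hnorm v by rewrite lt_neqAle eq_sym v0 hnorm_ge0.
have nV : Normc.normc ((hnorm v)^-1)%:C = (hnorm v)^-1.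
  by rewrite normc_real ger0_norm // invr_ge0 ltW.
have := @opnorm_ub1 a (((hnorm v)^-1)%:C *: v); rewrite -scalemxAl !hnormZ nV.
by rewrite mulVf // => /(_ (lexx _)); rewrite ler_pdivrMl // mulrC.
Qed.

Lemma opnorm_ge0 a : 0 <= opnorm a.
Proof. by apply: le_trans (hnorm_ge0 (0 *m a)) (opnorm_ub1 _ _); rewrite hnorm0. Qed.

Lemma normc_entry_le a i j : Normc.normc (a i j) <= opnorm a.
Proof.
have := opnorm_ub a (delta_mx 0 i); rewrite hnorm_delta mulr1; apply: le_trans.
by rewrite -rowE; apply: le_trans (normc_coord_le _ j); rewrite mxE.
Qed.

Lemma opnorm_le_entry a : opnorm a <= entry_sum a.
Proof. by apply: opnorm_le (entry_sum_ge0 a) _; exact: entry_sum_bound. Qed.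

Lemma opnormD a b : opnorm (a + b) <= opnorm a + opnorm b.
Proof.
apply: opnorm_le => [|v]; first by rewrite addr_ge0 ?opnorm_ge0.
rewrite mulmxDr mulrDl; apply: le_trans (hnormD _ _) _.
by rewrite lerD ?opnorm_ub.
Qed.

Lemma opnormZ_le c a : opnorm (c *: a) <= Normc.normc c * opnorm a.
Proof.
apply: opnorm_le => [|v]; first by rewrite mulr_ge0 ?normc_ge0 ?opnorm_ge0.
by rewrite -scalemxAr hnormZ -mulrA ler_wpM2l ?normc_ge0 ?opnorm_ub.
Qed.

Lemma opnormM a b : opnorm (a *m b) <= opnorm a * opnorm b.
Proof.
apply: opnorm_le => [|v]; first by rewrite mulr_ge0 ?opnorm_ge0.
rewrite mulmxA; apply: le_trans (opnorm_ub _ _) _.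
by rewrite (mulrC (opnorm a)) -mulrA ler_wpM2l ?opnorm_ge0 ?opnorm_ub.
Qed.

Lemma opnorm_eq0 a : opnorm a = 0 -> a = 0.
Proof.
move=> a0; apply/matrixP => i j; rewrite mxE.
apply: Normc.eq0_normc; apply/eqP.
by rewrite eq_le normc_ge0 andbT -a0 normc_entry_le.
Qed.

Definition adjmx a : 'M[C]_n := (map_mx Num.conj a)^T.

Lemma adjmxK : involutive adjmx.
Proof. by move=> a; apply/matrixP => i j; rewrite !mxE conjCK. Qed.

Lemma dot_adjmx a u v : dotmx (u *m a) v = dotmx u (v *m adjmx a).
Proof.
rewrite !dotmxE -mulmxA; congr ((_ *m _) 0 0).
apply/matrixP => i j; rewrite !mxE rmorph_sum; apply: eq_bigr => k _ /=.
by rewrite !mxE rmorphM /= conjCK mulrC.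
Qed.

(** The square of the length of [v *m a] is the inner product of [v] and
    [v *m a *m adjmx a], whence by Cauchy-Schwarz the inequality [<=] between
    the squared norm of [a] and the norm of [a *m adjmx a]. *)
Lemma opnorm_sqr_le a : opnorm a ^+ 2 <= opnorm (a *m adjmx a).
Proof.
have p0 := opnorm_ge0 (a *m adjmx a).
rewrite -[leRHS]sqr_sqrtr // ler_sqr ?nnegrE ?opnorm_ge0 ?sqrtr_ge0 //.
apply: opnorm_le => [|v]; first exact: sqrtr_ge0.
rewrite -[hnorm v]ger0_norm ?hnorm_ge0 // -sqrtr_sqr -sqrtrM //.
rewrite -[leLHS]ger0_norm ?hnorm_ge0 // -sqrtr_sqr ler_sqrt; last first.
  by rewrite mulr_ge0 ?sqr_ge0.
have -> : hnorm (v *m a) ^+ 2 = Normc.normc (dotmx v (v *m (a *m adjmx a))).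
  apply/complexI; rewrite hnorm_sqr dot_adjmx -mulmxA -normcE ger0_norm //.
  by rewrite mulmxA -dot_adjmx dnorm_ge0.
apply: le_trans (hnorm_dot _ _) _; rewrite expr2 mulrC [leRHS]mulrA.
by rewrite ler_wpM2r ?hnorm_ge0 ?opnorm_ub.
Qed.

Lemma opnorm_adj a : opnorm (adjmx a) = opnorm a.
Proof.
have le b : opnorm b <= opnorm (adjmx b).
  have := opnorm_ge0 b; rewrite le_eqVlt => /predU1P[<-|b0]; first exact: opnorm_ge0.
  by rewrite -(ler_pM2l b0) -expr2 (le_trans (opnorm_sqr_le _) (opnormM _ _)).
by apply/eqP; rewrite eq_le le andbT -{2}(adjmxK a) le.
Qed.

Lemma opnorm_cstar a : opnorm (adjmx a *m a) = opnorm a ^+ 2.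
Proof.
apply/eqP; rewrite eq_le; apply/andP; split.
  by rewrite expr2 -{1}(opnorm_adj a) opnormM.
by rewrite -opnorm_adj -{3}(adjmxK a) opnorm_sqr_le.
Qed.

End OperatorNorm.

Lemma real_cauchy_cvg (R : realType) (u : nat -> R) :
  (forall e : R, 0 < e ->
    exists N, forall m n, (N <= m)%N -> (N <= n)%N -> `|u m - u n| <= e) ->
  exists l, forall e : R, 0 < e -> exists N, forall n, (N <= n)%N -> `|u n - l| <= e.
Proof.
move=> cu.
have /cvg_ex[l /cvgrPdist_lt ul] : cvg (u @ \oo).
  apply: R_complete; apply/cauchyP => e e0.
  have [N hN] := cu _ (divr_gt0 e0 (ltr0Sn _ 1)).
  exists (u N); exists N => // n /= Nn; rewrite -ball_normE /ball_/=.
  by apply: le_lt_trans (hN _ _ (leqnn N) Nn) _; lra.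
exists l => e e0; have [N _ hN] := ul e e0.
by exists N => n Nn; rewrite distrC ltW // hN.
Qed.

Lemma normc_le_re_im (R : realType) (z : R[i]) :
  Normc.normc z <= `|complex.Re z| + `|complex.Im z|.
Proof.
rewrite -lecR rmorphD /= -normcE {1}(complexE z).
apply: le_trans (ler_normD _ _) _; rewrite normrM.
by rewrite !normcE /= !expr0n /= !addr0 !add0r expr1n sqrtr1 mul1r !sqrtr_sqr.
Qed.

Lemma re_le_normc (R : realType) (z : R[i]) : `|complex.Re z| <= Normc.normc z.
Proof. by case: z => x y /=; rewrite -sqrtr_sqr ler_wsqrtr // lerDl sqr_ge0. Qed.

Lemma im_le_normc (R : realType) (z : R[i]) : `|complex.Im z| <= Normc.normc z.
Proof. by case: z => x y /=; rewrite -sqrtr_sqr ler_wsqrtr // lerDr sqr_ge0. Qed.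

Section MatrixCStarAlgebra.
Variables (R : realType) (n : nat).
Local Notation C := R[i].
Local Notation M := 'M[C]_n.+1.

Let starD : {morph (@adjmx R n.+1) : a b / a + b}.
Proof. by move=> a b; apply/matrixP => i j; rewrite !mxE rmorphD. Qed.

Let starZ (c : C) (a : M) : adjmx (c *: a) = Num.conj c *: adjmx a.
Proof. by apply/matrixP => i j; rewrite !mxE rmorphM. Qed.

Let starM (a b : M) : adjmx (a * b) = adjmx b * adjmx a.
Proof.
apply/matrixP => i j; rewrite !mxE rmorph_sum; apply: eq_bigr => k _ /=.
by rewrite !mxE rmorphM /= mulrC.
Qed.

HB.instance Definition _ := hasStar.Build C M (@adjmxK R n.+1) starD starZ starM.

Let opnormZ (c : C) (a : M) : opnorm (c *: a) = Normc.normc c * opnorm a.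
Proof. exact: homogeneous_of_le (@opnorm_ge0 R n.+1) (@opnormZ_le R n.+1) _ _. Qed.

HB.instance Definition _ := hasCStarNorm.Build R M
  (@opnormD R n.+1) opnormZ (@opnorm_eq0 R n.+1) (@opnormM R n.+1) (@opnorm_cstar R n.+1).

Let mx_seq_complete (u : nat -> M) : cnorm_cauchy u -> exists a, cnorm_lim u a.
Proof.
move=> cu.
have entry_le (a : M) i j : Normc.normc (a i j) <= cnorm a by exact: normc_entry_le.
have /choice[l hl] (ij : 'I_n.+1 * 'I_n.+1) : exists z : C, forall e : R, 0 < e ->
    exists N, forall k, (N <= k)%N -> Normc.normc (u k ij.1 ij.2 - z) <= e.
  case: ij => i j /=.
  have [x hx] : exists x : R, forall e : R, 0 < e -> exists N, forall k, (N <= k)%N ->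
      `|complex.Re (u k i j) - x| <= e.
    apply: real_cauchy_cvg => e e0; have [N hN] := cu e e0.
    exists N => p q Np Nq; apply: le_trans (hN _ _ Np Nq).
    apply: le_trans (entry_le _ i j); rewrite !mxE.
    by rewrite -[X in `|X|](raddfB (@complex.Re R)) re_le_normc.
  have [y hy] : exists y : R, forall e : R, 0 < e -> exists N, forall k, (N <= k)%N ->
      `|complex.Im (u k i j) - y| <= e.
    apply: real_cauchy_cvg => e e0; have [N hN] := cu e e0.
    exists N => p q Np Nq; apply: le_trans (hN _ _ Np Nq).
    apply: le_trans (entry_le _ i j); rewrite !mxE.
    by rewrite -[X in `|X|](raddfB (@complex.Im R)) im_le_normc.
  exists (Complex x y) => e e0.
  have [N hN] := hx _ (divr_gt0 e0 (ltr0Sn _ 1)).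
  have [N' hN'] := hy _ (divr_gt0 e0 (ltr0Sn _ 1)).
  exists (maxn N N') => k; rewrite geq_max => /andP[Nk N'k].
  apply: le_trans (normc_le_re_im _) _; rewrite (splitr e).
  by move: (hN k Nk) (hN' k N'k); case: (u k i j) => a b /= *; rewrite lerD.
pose a : M := \matrix_(i, j) l (i, j).
exists a => e e0.
have d0 : 0 < e / (n.+1 * n.+1)%:R by rewrite divr_gt0 // ltr0n.
have /choice[N hN] ij : exists N, forall k, (N <= k)%N ->
    Normc.normc (u k ij.1 ij.2 - l ij) <= e / (n.+1 * n.+1)%:R by exact: hl.
exists (\max_ij N ij) => k Nk; apply: le_trans (opnorm_le_entry _) _.
have -> : e = \sum_(i < n.+1) \sum_(j < n.+1) (e / (n.+1 * n.+1)%:R).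
  by rewrite !sumr_const !card_ord -mulrnA -[RHS]mulr_natr divfK // pnatr_eq0.
do 2!(apply: ler_sum => ? _); rewrite !mxE.
by apply: (hN (_, _)); apply: leq_trans Nk; exact: leq_bigmax.
Qed.

HB.instance Definition _ :=
  isCStarComplete.Build R M (cstar_complete_of_seq mx_seq_complete).

End MatrixCStarAlgebra.

(** * Homomorphisms and the circle relations *)

Section StarHom.
Variables (C : numClosedFieldType) (A B : starAlgType C).

Lemma star1 : star (1 : A) = 1.
Proof. by rewrite -[LHS]mul1r -{1}(starK 1) -starM mul1r starK. Qed.

Lemma starN (a : A) : star (- a) = - star a.
Proof. by rewrite -scaleN1r starZ rmorphN rmorph1 scaleN1r. Qed.

Variables (f : A -> B) (hf : star_hom f).

Lemma star_homD a b : f (a + b) = f a + f b.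
Proof. by have [lf _ _] := hf; rewrite -[a]scale1r lf !scale1r. Qed.

Lemma star_hom0 : f 0 = 0.
Proof. by apply: (addrI (f 0)); rewrite -star_homD !addr0. Qed.

Lemma star_homZ c a : f (c *: a) = c *: f a.
Proof. by have [lf _ _] := hf; rewrite -[c *: a]addr0 lf star_hom0 addr0. Qed.

Lemma star_homN a : f (- a) = - f a.
Proof. by rewrite -scaleN1r star_homZ scaleN1r. Qed.

Lemma star_homM a b : f (a * b) = f a * f b.
Proof. by have [_ [_ ->] _] := hf. Qed.

Lemma star_hom1 : f 1 = 1.
Proof. by have [_ [-> _] _] := hf. Qed.

Lemma star_hom_star a : f (star a) = star (f a).
Proof. by have [_ _ ->] := hf. Qed.

Lemma star_homX a n : f (a ^+ n) = f a ^+ n.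
Proof.
elim: n => [|n IH]; first by rewrite !expr0 star_hom1.
by rewrite !exprS star_homM IH.
Qed.

End StarHom.

Lemma star_hom_id (C : numClosedFieldType) (A : starAlgType C) : star_hom (@id A).
Proof. by []. Qed.

Lemma star_hom_comp (C : numClosedFieldType) (A B D : starAlgType C)
    (f : A -> B) (g : B -> D) : star_hom f -> star_hom g -> star_hom (g \o f).
Proof.
move=> hf hg; split=> [c a b|| a] /=.
- by rewrite (star_homD hf) (star_homZ hf) (star_homD hg) (star_homZ hg).
- split=> [|a b] /=; first by rewrite (star_hom1 hf) (star_hom1 hg).
  by rewrite (star_homM hf) (star_homM hg).
- by rewrite (star_hom_star hf) (star_hom_star hg).
Qed.

Lemma star_hom_relations (R : realType) (A B : cstarAlgType R) (f : A -> B) x y :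
  star_hom f -> circle_relations x y -> circle_relations (f x) (f y).
Proof.
move=> hf [sx sy xy]; split; rewrite -?(star_hom_star hf) ?sx ?sy //.
by rewrite -!(star_homX hf) -(star_homD hf) xy (star_hom1 hf).
Qed.

Lemma circle_relationsN (R : realType) (A : cstarAlgType R) (x y : A) :
  circle_relations x y -> circle_relations (- x) (- y).
Proof. by move=> [sx sy xy]; split; rewrite ?starN ?sx ?sy ?sqrrN. Qed.

(** * Norm-continuous paths *)

Section ContinuousPaths.
Variables (R : realType) (B : cstarAlgType R).
Implicit Types f g : unit_interval R -> B.

Lemma continuous_cnormP (T : topologicalType) (f : T -> B) :
  continuous (f : T -> normed_space B) <->
  forall t e, 0 < e -> \forall s \near t, cnorm (f t - f s) < e.
Proof.
split=> [cf t e e0|cf t].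
  have /cvgrPdist_lt/(_ e%:C) := cf t; rewrite ltcR => /(_ e0).
  by apply: filterS => s; rewrite normed_spaceE ltcR.
apply/cvgrPdist_lt => eps /complexR_gt0[e0 ->].
by apply: filterS (cf t _ e0) => s; rewrite normed_spaceE ltcR.
Qed.

Definition path_set f := bounded_fct f /\ continuous (f : _ -> normed_space B).

Lemma path_bounded f : path_set f -> bounded_fct f.
Proof. by case. Qed.

Lemma path_cst b : path_set (fun=> b).
Proof. by split; [exists (cnorm b)|exact: cst_continuous]. Qed.

Lemma path_lin (c : R[i]) f g : path_set f -> path_set g -> path_set (c *: f + g).
Proof.
move=> [[M fM] /continuous_cnormP cf] [[N gN] /continuous_cnormP cg]; split.
  by apply: bounded_lin; [exists M|exists N].
apply/continuous_cnormP => t e e0.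
have c1 : 0 < Normc.normc c + 1 by rewrite ltr_wpDl ?normc_ge0.
have e2 : 0 < e / 2 by rewrite divr_gt0.
have ec : 0 < e / 2 / (Normc.normc c + 1) by rewrite divr_gt0.
apply: filterS2 (cf t _ ec) (cg t _ e2) => s fs gs.
have -> : (c *: f + g) t - (c *: f + g) s = c *: (f t - f s) + (g t - g s).
  by rewrite scalerBr addrACA -opprD.
apply: le_lt_trans (cnormD _ _) _; rewrite (splitr e) ler_ltD // cnormZ.
apply: le_trans (ler_wpM2l (normc_ge0 c) (ltW fs)) _.
by rewrite mulrCA ger_pMr // ler_pdivrMr // mul1r lerDl.
Qed.

Lemma path_add f g : path_set f -> path_set g -> path_set (fun t => f t + g t).
Proof. by move=> pf pg; have := path_lin 1 pf pg; rewrite scale1r. Qed.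

Lemma path_mul f g : path_set f -> path_set g -> path_set (f * g).
Proof.
move=> [[M fM] /continuous_cnormP cf] [[N gN] /continuous_cnormP cg].
have M0 : 0 <= M := le_trans (cnorm_ge0 _) (fM (itv0 R)).
have N0 : 0 <= N := le_trans (cnorm_ge0 _) (gN (itv0 R)).
split.
  by apply: bounded_mul; [exists M|exists N].
apply/continuous_cnormP => t e e0.
have M1 : 0 < M + 1 by rewrite ltr_wpDl.
have N1 : 0 < N + 1 by rewrite ltr_wpDl.
have e2 : 0 < e / 2 by rewrite divr_gt0.
have eM : 0 < e / 2 / (M + 1) by rewrite divr_gt0.
have eN : 0 < e / 2 / (N + 1) by rewrite divr_gt0.
apply: filterS2 (cf t _ eN) (cg t _ eM) => s fs gs.
have -> : (f * g) t - (f * g) s = f t * (g t - g s) + (f t - f s) * g s.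
  by rewrite mulrBr mulrBl addrA subrK.
apply: le_lt_trans (cnormD _ _) _; rewrite (splitr e).
apply: ler_ltD; apply: le_lt_trans (cnormM _ _) _ || apply: le_trans (cnormM _ _) _.
  apply: le_trans (ler_pM (cnorm_ge0 _) (cnorm_ge0 _) (fM t) (ltW gs)) _.
  by rewrite mulrCA ger_pMr // ler_pdivrMr // mul1r lerDl.
apply: le_lt_trans (ler_pM (cnorm_ge0 _) (cnorm_ge0 _) (ltW fs) (gN s)) _.
by rewrite mulrAC -mulrA gtr_pMr // ltr_pdivrMr // mul1r ltrDl.
Qed.

Lemma path_star f : path_set f -> path_set (star f).
Proof.
move=> [bf /continuous_cnormP cf]; split; first exact: bounded_star.
apply/continuous_cnormP => t e e0; apply: filterS (cf t e e0) => s.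
by rewrite -[X in X < e -> _]cnorm_star starD starN.
Qed.

Lemma path_lim f :
  (forall e, 0 < e -> exists2 g, path_set g & forall t, cnorm (f t - g t) <= e) ->
  path_set f.
Proof.
move=> happrox; split.
  by apply: bounded_lim => e /happrox[g [bg _] fg]; exists g.
apply/continuous_cnormP => t e e0.
have e4 : 0 < e / 4 by rewrite divr_gt0.
have e2 : 0 < e / 2 by rewrite divr_gt0.
have [g [_ /continuous_cnormP cg] fg] := happrox _ e4.
apply: filterS (cg t _ e2) => s gs.
apply: le_lt_trans (cnorm_triangle _ (g t) _) _.
apply: le_lt_trans (lerD (lexx _) (cnorm_triangle _ (g s) _)) _.
(* An approximation within [e / 4] whose variation is below [e / 2]. *)
rewrite (cnormBC (g s)); have := fg t; have := fg s; move: gs.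
by set x := cnorm _; set y := cnorm _; set z := cnorm _; lra.
Qed.

Definition path_cstar : fun_cstar (unit_interval R) B :=
  FunCStar path_bounded (path_cst 1) path_lin path_mul path_star path_lim.

End ContinuousPaths.

Section CircleAlgebra.
Variables (R : realType) (A : cstarAlgType R).
Implicit Types x y m : A.

Lemma star_realZ (r : R) x : star (r%:C *: x) = r%:C *: star x.
Proof. by rewrite starZ; congr (_ *: _); exact: conjc_real. Qed.

Lemma sqr_realZ (r : R) x : (r%:C *: x) ^+ 2 = (r ^+ 2)%:C *: x ^+ 2.
Proof. by rewrite exprZn rmorphXn. Qed.

Lemma sqr_lin2 (r s : R) x y : (r%:C *: x + s%:C *: y) ^+ 2 =
  (r ^+ 2)%:C *: x ^+ 2 + (s ^+ 2)%:C *: y ^+ 2 + (r * s)%:C *: (x * y + y * x).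
Proof.
rewrite expr2 mulrDl !mulrDr -!scalerAl -!scalerAr !scalerA -!rmorphM -!expr2.
by rewrite (mulrC s r) scalerDr -!addrA; congr (_ + _); rewrite addrA addrC.
Qed.

(** The anticommutators of the two new generators cancel. *)
Lemma circle_relations_rot (c s : R) x y : c ^+ 2 + s ^+ 2 = 1 ->
  circle_relations x y ->
  circle_relations (c%:C *: x + s%:C *: y) (- s%:C *: x + c%:C *: y).
Proof.
move=> cs1 [sx sy xy]; rewrite -rmorphN; split; rewrite ?starD ?star_realZ ?sx ?sy //.
rewrite !sqr_lin2 sqrrN addrACA mulNr (mulrC s c) rmorphN scaleNr subrr addr0.
rewrite addrACA -!scalerDl -!rmorphD /= (addrC (s ^+ 2)) cs1 rmorph1.
by rewrite !scale1r xy.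
Qed.

Lemma rotation_inverse (c s : R) x y : c ^+ 2 + s ^+ 2 = 1 ->
  c%:C *: (c%:C *: x + s%:C *: y) - s%:C *: (- s%:C *: x + c%:C *: y) = x /\
  s%:C *: (c%:C *: x + s%:C *: y) + c%:C *: (- s%:C *: x + c%:C *: y) = y.
Proof.
move=> cs; rewrite !scalerDr !scalerA; split.
  rewrite opprD addrACA (mulrC s%:C c%:C) subrr addr0 -scalerBl.
  by rewrite mulrN opprK -!rmorphM -rmorphD /= -!expr2 cs scale1r.
rewrite addrACA mulrN (mulrC s%:C c%:C) scaleNr subrr add0r -scalerDl.
by rewrite -!rmorphM -rmorphD /= -!expr2 addrC cs scale1r.
Qed.

(** The unit [m] anticommutes with [x], so that [s x + c m] squares to
    [s^2 x^2 + c^2]. *)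
Lemma circle_relations_join (c s : R) x y m : c ^+ 2 + s ^+ 2 = 1 ->
  star m = m -> m ^+ 2 = 1 -> m * x = - (x * m) -> circle_relations x y ->
  circle_relations (s%:C *: x + c%:C *: m) (s%:C *: y).
Proof.
move=> cs1 sm m2 mx [sx sy xy]; split; rewrite ?starD ?star_realZ ?sx ?sy ?sm //.
rewrite sqr_lin2 sqr_realZ mx subrr scaler0 addr0 addrAC -scalerDr xy m2.
by rewrite -scalerDl -rmorphD /= addrC cs1 rmorph1 scale1r.
Qed.

End CircleAlgebra.

Section TrigonometricPaths.
Variable R : realType.
Implicit Types (B : cstarAlgType R) (t : unit_interval R).

Definition param t : R := set_val t.

Lemma param_continuous : continuous param.
Proof. exact: initial_continuous. Qed.

Lemma path_scale B (h : R -> R) (b : B) :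
  continuous h -> (forall r, `|h r| <= 1) ->
  path_set (fun t => (h (param t))%:C *: b).
Proof.
move=> ch h1; split.
  exists (cnorm b) => t; rewrite cnormZ -[leRHS]mul1r ler_wpM2r ?cnorm_ge0 //.
  by rewrite normc_real.
apply/continuous_cnormP => t e e0.
have b1 : 0 < cnorm b + 1 by rewrite ltr_wpDl ?cnorm_ge0.
have hc : continuous (h \o param).
  by move=> s; apply: continuous_comp; [exact: param_continuous|exact: ch].
have /cvgrPdist_lt/(_ (e / (cnorm b + 1))) := hc t.
rewrite divr_gt0 // => /(_ isT); apply: filterS => s /= hs.
rewrite -scalerBl -rmorphB cnormZ normc_real.
apply: le_lt_trans (ler_wpM2r (cnorm_ge0 b) (ltW hs)) _.
by rewrite -mulrA gtr_pMr // mulrC ltr_pdivrMr // mul1r ltrDl.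
Qed.

Definition path_angle (a b : R) t : R := a * param t + b.

Lemma path_sin B a b (d : B) :
  path_set (fun t => (sin (path_angle a b t))%:C *: d).
Proof.
apply: (@path_scale _ (fun r => sin (a * r + b))) => [|r].
  move=> r; apply: continuous_comp; last exact: continuous_sin.
  by apply: cvgD; [apply: cvgMr; exact: cvg_id|exact: cvg_cst].
by rewrite ler_norml sin_geN1 sin_le1.
Qed.

Lemma path_cos B a b (d : B) :
  path_set (fun t => (cos (path_angle a b t))%:C *: d).
Proof.
apply: (@path_scale _ (fun r => cos (a * r + b))) => [|r].
  move=> r; apply: continuous_comp; last exact: continuous_cos.
  by apply: cvgD; [apply: cvgMr; exact: cvg_id|exact: cvg_cst].
by rewrite ler_norml cos_geN1 cos_le1.
Qed.

Lemma path_angle0 a b : path_angle a b (itv0 R) = b.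
Proof. by rewrite /path_angle mulr0 add0r. Qed.

Lemma path_angle1 a b : path_angle a b (itv1 R) = a + b.
Proof. by rewrite /path_angle mulr1. Qed.

End TrigonometricPaths.

(** * Actions generated by an involution *)

Lemma I2P (i : 'I_2) : i = 0 \/ i = 1.
Proof. by case: i => -[|[|//]] i; [left|right]; apply/val_inj. Qed.

Lemma sum2 (V : nmodType) (F : 'I_2 -> V) : \sum_i F i = F 0 + F 1.
Proof. by rewrite big_ord_recl big_ord1; congr (_ + F _); apply/val_inj. Qed.

Section InvolutionAction.
Variables (R : realType) (A : cstarAlgType R) (tau : A -> A).
Hypotheses (tau_hom : star_hom tau) (tauK : involutive tau).

Definition iter_action (g : 'Z_2) (a : A) : A := iter g tau a.

Lemma iter_involution n a : iter n tau a = if odd n then tau a else a.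
Proof. by elim: n => [|n IH] //=; rewrite IH; case: odd => //=; rewrite tauK. Qed.

Lemma iter_action_is_action : is_action iter_action.
Proof.
split=> [g|//|g h a]; last first.
  by rewrite /iter_action /= -iterD !iter_involution /= modn2 oddb.
have -> : iter_action g = if odd g then tau else id.
  by apply/funext => a; rewrite /iter_action iter_involution; case: odd.
case: odd; first by split=> //; exists tau.
by split; [exact: star_hom_id|exists id].
Qed.

(** For the sign character, [1 = x x^* + y y^*] with [x] and [y] in the spectral
    subspace; for the trivial one, [1 = 1 1^*]. *)
Lemma iter_action_free (x y : A) : circle_relations x y ->
  tau x = - x -> tau y = - y -> free_action iter_action.
Proof.
move=> [sx sy xy] tx ty gamma [g_norm gD]; apply: subset_closure.
have g0 : gamma 0 = 1.
  have g00 : gamma 0 * gamma 0 = gamma 0 * 1 by rewrite -gD addr0 mulr1.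
  apply: mulfI g00; apply/eqP => g0.
  by have := g_norm 0; rewrite g0 normr0 => /eqP; rewrite eq_sym oner_eq0.
have spectral a : tau a = gamma 1 *: a -> spectral_subspace iter_action gamma a.
  by move=> ta g; have [->|->] := I2P g; rewrite ?g0 ?scale1r.
have : gamma 1 ^+ 2 == 1 ^+ 2.
  by rewrite expr2 -gD expr1n -g0; apply/eqP; congr gamma; apply/val_inj.
rewrite eqf_sqr => /orP[/eqP g1|/eqP g1].
  exists 1%N, (fun=> 1), (fun=> 1), (fun=> 1); split.
  - by move=> _; apply: spectral; rewrite g1 scale1r (star_hom1 tau_hom).
  - by move=> _; apply: spectral; rewrite g1 scale1r (star_hom1 tau_hom).
  - by rewrite big_ord1 scale1r star1 mulr1.
pose v (i : 'I_2) := if i == 0 then x else y.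
have vP i : spectral_subspace iter_action gamma (v i).
  by apply: spectral; rewrite /v g1 scaleN1r; case: ifP.
exists 2%N, (fun=> 1), v, v; split=> //.
by rewrite sum2 /v /= !scale1r sx sy -!expr2 xy.
Qed.

End InvolutionAction.

(** Convergence for the pointwise topology is convergence of all evaluations. *)
Lemma connected_to_id_path (R : realType) (A : cstarAlgType R)
    (p : unit_interval R -> A -> A) :
  (forall a, continuous ((fun t => p t a) : _ -> normed_space A)) ->
  (forall t, star_aut (p t)) -> p (itv1 R) = id ->
  connected_to_id (p (itv0 R)).
Proof.
move=> cp ap p1; exists p; split=> // t.
have FF : Filter (fmap p (nbhs t)) by apply: fmap_filter; exact: nbhs_filter.
have cpt := @pointwise_cvgP (normed_space A) (normed_space A) _ (p t) FF.
exact: (cpt.2 (fun a => cp a t)).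
Qed.

Lemma connected_to_id_id (R : realType) (A : cstarAlgType R) :
  connected_to_id (@id A).
Proof.
apply: (@connected_to_id_path _ _ (fun=> id)) => // [a|t].
  exact: cst_continuous.
by split; [exact: star_hom_id|exists id].
Qed.


(** * Crossed products by involutions *)

Lemma exp_2pi_over2 (R : realType) : exp_2pi_over R 2 = -1.
Proof.
rewrite /exp_2pi_over (_ : 2 * pi / 2%:R = pi); last by rewrite mulrAC divff ?mul1r.
by rewrite cospi sinpi; apply/eqP; rewrite eq_complex /= oppr0 !eqxx.
Qed.

Section CrossedProductZ2.
Variables (R : realType) (A : cstarAlgType R) (beta : 'Z_2 -> A -> A).
Variable X : crossed_product beta.
Local Notation inj := (cp_inj X).
Local Notation mu := (cp_mu X).

Lemma cp_muK : mu * mu = 1.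
Proof. by rewrite -expr2 cp_mu_order. Qed.

Lemma star_cp_mu : star mu = mu.
Proof. by rewrite -[LHS]mulr1 -cp_muK mulrA (cp_mu_unitary X).1 mul1r. Qed.

Lemma cp_mu_inj a : mu * inj a = inj (beta 1 a) * mu.
Proof. by rewrite -cp_covariant star_cp_mu -mulrA cp_muK mulr1. Qed.

Definition cp_pair a0 a1 : X := inj a0 + inj a1 * mu.

Lemma cp_pairE b : b = cp_pair (cp_coef b 0) (cp_coef b 1).
Proof.
by rewrite {1}(cp_expand b) sum2 expr0 mulr1 expr1.
Qed.

Lemma cp_coef_pair a0 a1 :
  cp_coef (cp_pair a0 a1) 0 = a0 /\ cp_coef (cp_pair a0 a1) 1 = a1.
Proof.
have -> : cp_pair a0 a1 =
    \sum_(j < 2) inj (if j == 0 then a0 else a1) * mu ^+ j.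
  by rewrite sum2 expr0 mulr1 expr1.
by rewrite !cp_unique.
Qed.

Lemma twisted_aut_pair (alpha : 'Z_2 -> A -> A) a0 a1 :
  twisted_aut alpha (cp_pair a0 a1) =
  inj (alpha 1 a0) + -1 *: (inj (alpha 1 a1) * mu).
Proof.
have [c0 c1] := cp_coef_pair a0 a1.
by rewrite /twisted_aut sum2 exp_2pi_over2 !expr0 mulr1 scale1r c0 c1 !expr1.
Qed.

Variable alpha : 'Z_2 -> A -> A.
Hypotheses (alpha_hom : star_hom (alpha 1))
  (alpha_beta : forall a, alpha 1 (beta 1 a) = beta 1 (alpha 1 a)).

Let injh : star_hom inj := cp_inj_hom X.

(* Taken with [e = 1] for the product in the crossed product, and with [e = -1]
   for the product of two images under the twisted automorphism. *)
Let signed_mul (e : R[i]) a0 a1 b0 b1 : e * e = 1 ->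
  (inj a0 + e *: (inj a1 * mu)) * (inj b0 + e *: (inj b1 * mu)) =
  inj (a0 * b0 + a1 * beta 1 b1) + e *: (inj (a0 * b1 + a1 * beta 1 b0) * mu).
Proof.
move=> ee; rewrite !(star_homD injh) !(star_homM injh) mulrDl !mulrDr.
rewrite -!scalerAl -!scalerAr scalerA ee scale1r.
rewrite -!(mulrA (inj a1)) !(mulrA mu) !cp_mu_inj -!mulrA cp_muK mulr1.
by rewrite mulrDl scalerDr !mulrA -!addrA; congr (_ + _); rewrite addrA addrC.
Qed.

Let mul_pair a0 a1 b0 b1 : cp_pair a0 a1 * cp_pair b0 b1 =
  cp_pair (a0 * b0 + a1 * beta 1 b1) (a0 * b1 + a1 * beta 1 b0).
Proof. by have := signed_mul a0 a1 b0 b1 (mulr1 1); rewrite !scale1r. Qed.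

Let star_pair a0 a1 : star (cp_pair a0 a1) = cp_pair (star a0) (beta 1 (star a1)).
Proof.
by rewrite starD starM star_cp_mu -!(star_hom_star injh) cp_mu_inj.
Qed.

(** The twisted automorphism combines [alpha], which commutes with [beta], with
    the dual automorphism [mu |-> - mu]. *)
Lemma twisted_aut_hom : star_hom (twisted_aut alpha : X -> X).
Proof.
split=> [c a b|| a].
- rewrite (cp_pairE a) (cp_pairE b).
  move: (cp_coef a 0) (cp_coef a 1) (cp_coef b 0) (cp_coef b 1) => a0 a1 b0 b1.
  have -> : c *: cp_pair a0 a1 + cp_pair b0 b1 = cp_pair (c *: a0 + b0) (c *: a1 + b1).
    rewrite /cp_pair !(star_homD injh) !(star_homZ injh) mulrDl scalerDr -scalerAl.
    by rewrite addrACA.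
  rewrite !twisted_aut_pair !(star_homD alpha_hom) !(star_homZ alpha_hom).
  rewrite !(star_homD injh) !(star_homZ injh) mulrDl !scalerDr -scalerAl.
  by rewrite addrACA !scalerA mulrC.
- split=> [|a b].
    have -> : 1 = cp_pair 1 0 by rewrite /cp_pair (star_hom0 injh) mul0r addr0 (star_hom1 injh).
    rewrite twisted_aut_pair (star_hom0 alpha_hom) (star_hom1 alpha_hom).
    by rewrite /cp_pair (star_hom0 injh) mul0r scaler0.
  rewrite (cp_pairE a) (cp_pairE b) mul_pair !twisted_aut_pair.
  rewrite signed_mul ?mulrNN ?mulr1 //.
  by rewrite !(star_homD alpha_hom) !(star_homM alpha_hom) !alpha_beta.
- rewrite (cp_pairE a) star_pair !twisted_aut_pair starD starZ rmorphN rmorph1 starM star_cp_mu.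
  rewrite -!(star_hom_star injh) cp_mu_inj !(star_hom_star alpha_hom).
  by rewrite alpha_beta (star_hom_star alpha_hom).
Qed.

End CrossedProductZ2.

(** Both actions iterate the automorphism of the generator. *)
Lemma equivariant_iter (R : realType) (A : cstarAlgType R) (tau : A -> A)
    (beta : 'Z_2 -> A -> A) (X : crossed_product beta)
    (phi : A -> unit_interval R -> X) :
  (forall a t, phi (tau a) t = twisted_aut (iter_action tau) (phi a t)) ->
  equivariant (iter_action tau) (twisted_action (iter_action tau)) phi.
Proof.
move=> phi1 g; apply/funext => a; apply/funext => t; rewrite /= /twisted_action /iter_action.
by elim: (val g) => //= n IH; rewrite phi1 IH.
Qed.

Section FunctionAlgebraHoms.
Variables (R : realType) (T : pointedType) (B : cstarAlgType R) (S : fun_cstar T B).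

Lemma fc_val_hom : star_hom (@fc_val R T B S).
Proof. by split=> //; split. Qed.

Lemma fc_relations (u v : fc_alg S) :
  (forall t, circle_relations (fc_val u t) (fc_val v t)) -> circle_relations u v.
Proof.
by move=> uv; split; apply: fc_ext => t; have [su sv uv1] := uv t.
Qed.

End FunctionAlgebraHoms.

Lemma circle_relations10 (R : realType) (B : cstarAlgType R) :
  circle_relations (1 : B) 0.
Proof.
split; [exact: star1| |by rewrite expr1n expr0n addr0].
by rewrite -(scale0r 0) starZ rmorph0 !scale0r.
Qed.

(** * Spans of self-adjoint unitaries *)

Section TwoCharacters.
Variables (R : realType) (A B : cstarAlgType R) (m : B).
Hypotheses (sm : star m = m) (m2 : m * m = 1).

Definition unit_span (c d : R[i]) : B := c *: 1 + d *: m.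

Lemma unit_spanD e c d c' d' :
  e *: unit_span c d + unit_span c' d' = unit_span (e * c + c') (e * d + d').
Proof. by rewrite /unit_span scalerDr !scalerA addrACA -!scalerDl. Qed.

Lemma unit_spanM c d c' d' :
  unit_span c d * unit_span c' d' = unit_span (c * c' + d * d') (c * d' + d * c').
Proof.
rewrite /unit_span mulrDl !mulrDr -!scalerAl -!scalerAr !scalerA m2 !mul1r mulr1.
by rewrite !scalerDl -!addrA; congr (_ + _); rewrite addrA addrC.
Qed.

Lemma unit_span_star c d : star (unit_span c d) = unit_span (Num.conj c) (Num.conj d).
Proof. by rewrite /unit_span starD !starZ star1 sm. Qed.

(** The sum of [pi1] times [(1 + m) / 2] and of [pi2] times [(1 - m) / 2], two
    complementary projections. Characters are written as maps to 1 x 1 matrices,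
    the complex numbers as a C*-algebra. *)
Definition character_join (pi1 pi2 : A -> 'M[R[i]]_1) (a : A) : B :=
  unit_span ((pi1 a 0 0 + pi2 a 0 0) / 2) ((pi1 a 0 0 - pi2 a 0 0) / 2).

Lemma character_join_hom (pi1 pi2 : A -> 'M[R[i]]_1) :
  star_hom pi1 -> star_hom pi2 -> star_hom (character_join pi1 pi2).
Proof.
move=> h1 h2; rewrite /character_join; split=> [c a b|| a].
- rewrite unit_spanD (star_homD h1) (star_homD h2) (star_homZ h1) (star_homZ h2) !mxE.
  by congr unit_span; field.
- split=> [|a b].
    rewrite (star_hom1 h1) (star_hom1 h2) !mxE eqxx /= subrr mul0r.
    by rewrite /unit_span scale0r addr0 -mulr2n divff ?scale1r // pnatr_eq0.
  rewrite unit_spanM (star_homM h1) (star_homM h2) !mxE !big_ord1.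
  by congr unit_span; field.
- rewrite unit_span_star (star_hom_star h1) (star_hom_star h2) !mxE.
  by rewrite !rmorphM rmorphD rmorphB !fmorphV !rmorph_nat.
Qed.

End TwoCharacters.

(** * The universal algebra of the noncommutative circle *)

Section UniversalCircle.
Variables (R : realType) (A : cstarAlgType R) (x y : A).
Hypothesis U : universal_circle x y.

Lemma universal_hom (B : cstarAlgType R) (u v : B) : circle_relations u v ->
  {phi : A -> B | [/\ star_hom phi, phi x = u & phi y = v]}.
Proof. by move=> uv; apply: cid; have [phi [h _]] := U.2 B u v uv; exists phi. Qed.

Lemma universal_ext (B : cstarAlgType R) (f g : A -> B) :
  star_hom f -> star_hom g -> f x = g x -> f y = g y -> f =1 g.
Proof.
move=> hf hg fgx fgy a.
have [phi [_ phiU]] := U.2 B _ _ (star_hom_relations hf U.1).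
by rewrite -(phiU f) // -(phiU g).
Qed.

Definition antipode : A -> A := sval (universal_hom (circle_relationsN U.1)).

Lemma antipode_hom : star_hom antipode.
Proof. by rewrite /antipode; case: universal_hom => ? []. Qed.

Lemma antipode_x : antipode x = - x.
Proof. by rewrite /antipode; case: universal_hom => ? []. Qed.

Lemma antipode_y : antipode y = - y.
Proof. by rewrite /antipode; case: universal_hom => ? []. Qed.

Lemma antipodeK : involutive antipode.
Proof.
apply: (universal_ext (star_hom_comp antipode_hom antipode_hom) (star_hom_id A)) => /=.
  by rewrite antipode_x (star_homN antipode_hom) antipode_x opprK.
by rewrite antipode_y (star_homN antipode_hom) antipode_y opprK.
Qed.

(** The path rotates [(x, y)] through the angle [pi (1 - t)]. The universal
    property is applied to the algebra of continuous paths, so that continuity of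
    [t |-> p t a] comes for free for every [a]. *)
Lemma antipode_connected : connected_to_id antipode.
Proof.
pose th := path_angle (- pi) (pi : R).
have rel t := circle_relations_rot (cos2Dsin2 (th t)) U.1.
have Pu : path_set (fun t => (cos (th t))%:C *: x + (sin (th t))%:C *: y).
  by apply: path_add; [exact: path_cos|exact: path_sin].
have Pv : path_set (fun t => - (sin (th t))%:C *: x + (cos (th t))%:C *: y).
  apply: path_add; last exact: path_cos.
  have -> : (fun t => - (sin (th t))%:C *: x) = (fun t => (sin (th t))%:C *: (- x)).
    by apply/funext => t; rewrite scaleNr scalerN.
  exact: path_sin.
have [Phi [hPhi Phix Phiy]] : {Phi : A -> fc_alg (path_cstar A) |
    [/\ star_hom Phi, Phi x = to_fc (S := path_cstar A) Pu
      & Phi y = to_fc (S := path_cstar A) Pv]}.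
  by apply: universal_hom; apply: fc_relations => t; exact: rel.
pose p t a := fc_val (Phi a) t.
have hp t : star_hom (p t) := star_hom_comp hPhi (fc_eval_hom _ t).
have px t : p t x = (cos (th t))%:C *: x + (sin (th t))%:C *: y by rewrite /p Phix.
have py t : p t y = - (sin (th t))%:C *: x + (cos (th t))%:C *: y by rewrite /p Phiy.
have p0 : p (itv0 R) = antipode.
  apply/funext/universal_ext; [exact: hp|exact: antipode_hom| |].
    by rewrite px antipode_x /th path_angle0 cospi sinpi rmorphN rmorph1 rmorph0
      scaleN1r scale0r addr0.
  by rewrite py antipode_y /th path_angle0 cospi sinpi rmorphN rmorph1 rmorph0
    oppr0 scaleN1r scale0r add0r.
rewrite -p0; apply: connected_to_id_path => [a|t|].
- exact: (fc_inP (Phi a)).2.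
- split; first exact: hp.
  have cs' : cos (th t) ^+ 2 + (- sin (th t)) ^+ 2 = 1 by rewrite sqrrN cos2Dsin2.
  have sE : (sin (th t))%:C = - (- sin (th t))%:C by rewrite rmorphN opprK.
  have [q [hq qx qy]] := universal_hom (circle_relations_rot cs' U.1).
  exists q.
    apply: (universal_ext (star_hom_comp (hp t) hq) (star_hom_id A)) => /=.
      rewrite px (star_homD hq) !(star_homZ hq) qx qy sE scaleNr.
      exact: (rotation_inverse x y cs').1.
    rewrite py (star_homD hq) !(star_homZ hq) qx qy sE opprK.
    exact: (rotation_inverse x y cs').2.
  apply: (universal_ext (star_hom_comp hq (hp t)) (star_hom_id A)) => /=.
    rewrite qx (star_homD (hp t)) !(star_homZ (hp t)) px py rmorphN scaleNr.
    exact: (rotation_inverse x y (cos2Dsin2 (th t))).1.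
  rewrite qy (star_homD (hp t)) !(star_homZ (hp t)) px py rmorphN opprK.
  exact: (rotation_inverse x y (cos2Dsin2 (th t))).2.
- apply/funext/universal_ext; [exact: hp|exact: star_hom_id| |].
    by rewrite px /th path_angle1 addNr cos0 sin0 rmorph1 rmorph0 scale1r scale0r addr0.
  by rewrite py /th path_angle1 addNr cos0 sin0 rmorph1 rmorph0 oppr0 scale1r scale0r add0r.
Qed.

Section Join.
Variable X : crossed_product (iter_action antipode).
Local Notation inj := (cp_inj X).
Local Notation mu := (cp_mu X).
Let th : unit_interval R -> R := path_angle (pi / 2) 0.

Let cp_mu_x : mu * inj x = - (inj x * mu).
Proof.
by rewrite cp_mu_inj /iter_action /= antipode_x (star_homN (cp_inj_hom X)) mulNr.
Qed.

Let join_u t : X := (sin (th t))%:C *: inj x + (cos (th t))%:C *: mu.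
Let join_v t : X := (sin (th t))%:C *: inj y.

Let path_u : path_set join_u.
Proof. by apply: path_add; [exact: path_sin|exact: path_cos]. Qed.

Let path_v : path_set join_v.
Proof. exact: path_sin. Qed.

Let join_rel t : circle_relations (join_u t) (join_v t).
Proof.
apply: circle_relations_join cp_mu_x _; rewrite ?cos2Dsin2 ?star_cp_mu ?cp_mu_order //.
exact: star_hom_relations (cp_inj_hom X) U.1.
Qed.

(** As above, the target of the universal property is the algebra of all
    continuous paths in [X]; the end points are then identified by uniqueness. At
    [0] the pair is [(mu, 0)], whose homomorphism is glued from the characters
    sending [(x, y)] to [(1, 0)] and to [(-1, 0)]. *)
Lemma universal_join : has_equivariant_hom_to_join (iter_action antipode) X.
Proof.
have injh := cp_inj_hom X.
have [Phi [hPhi Phix Phiy]] : {Phi : A -> fc_alg (path_cstar X) |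
    [/\ star_hom Phi, Phi x = to_fc (S := path_cstar X) path_u
      & Phi y = to_fc (S := path_cstar X) path_v]}.
  by apply: universal_hom; apply: fc_relations => t; exact: join_rel.
have hp t : star_hom (fun a => fc_val (Phi a) t) := star_hom_comp hPhi (fc_eval_hom _ t).
have px t : fc_val (Phi x) t = join_u t by rewrite Phix.
have py t : fc_val (Phi y) t = join_v t by rewrite Phiy.
exists (fun a => fc_val (Phi a)); split.
- exact: star_hom_comp hPhi (fc_val_hom _).
- move=> a; split.
  + exact: (fc_inP (Phi a)).2.
  + have rel1 := circle_relations10 'M[R[i]]_1.
    have [pi1 [h1 x1 y1]] := universal_hom rel1.
    have relN : circle_relations (-1 : 'M[R[i]]_1) 0.
      by have := circle_relationsN rel1; rewrite oppr0.
    have [pi2 [h2 x2 y2]] := universal_hom relN.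
    have -> : fc_val (Phi a) (itv0 R) = character_join mu pi1 pi2 a.
      apply: (universal_ext (hp _) (character_join_hom (star_cp_mu X) (cp_muK X) h1 h2)).
        rewrite px /join_u /th path_angle0 sin0 cos0 rmorph0 rmorph1 scale0r add0r.
        rewrite /character_join /unit_span x1 x2 !mxE eqxx subrr mul0r scale0r add0r opprK.
        by rewrite -mulr2n divff // pnatr_eq0.
      rewrite py /join_v /th path_angle0 sin0 rmorph0 scale0r.
      by rewrite /character_join /unit_span y1 y2 !mxE subrr addr0 mul0r !scale0r addr0.
    exists (fun j => if j == 0 then (pi1 a 0 0 + pi2 a 0 0) / 2
                     else (pi1 a 0 0 - pi2 a 0 0) / 2).
    by rewrite sum2 expr0 expr1.
  + exists a => //; apply: (universal_ext injh (hp _)).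
      rewrite px /join_u /th path_angle1 addr0 sin_pihalf cos_pihalf rmorph1 rmorph0.
      by rewrite scale1r scale0r addr0.
    by rewrite py /join_v /th path_angle1 addr0 sin_pihalf rmorph1 scale1r.
- apply: equivariant_iter => a t.
  have htw : star_hom (twisted_aut (iter_action antipode) : X -> X).
    by apply: twisted_aut_hom; [exact: antipode_hom|].
  apply: (universal_ext (star_hom_comp antipode_hom (hp t)) (star_hom_comp (hp t) htw)) => /=.
    rewrite antipode_x (star_homN (hp t)) px.
    have -> : join_u t = cp_pair X ((sin (th t))%:C *: x) ((cos (th t))%:C *: 1).
      by rewrite /cp_pair !(star_homZ injh) (star_hom1 injh) -scalerAl mul1r.
    rewrite twisted_aut_pair /iter_action /= !(star_homZ antipode_hom) antipode_x.
    rewrite (star_hom1 antipode_hom) scalerN (star_homN injh) scaleN1r.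
    by rewrite /cp_pair opprD.
  rewrite antipode_y (star_homN (hp t)) py.
  have -> : join_v t = cp_pair X ((sin (th t))%:C *: y) 0.
    by rewrite /cp_pair (star_homZ injh) (star_hom0 injh) mul0r addr0.
  rewrite twisted_aut_pair /iter_action /= (star_homZ antipode_hom) antipode_y.
  rewrite (star_hom0 antipode_hom) scalerN (star_homN injh).
  by rewrite /cp_pair (star_hom0 injh) mul0r scaler0 !addr0.
Qed.

End Join.

End UniversalCircle.

(** * Generated algebras and their transport *)

Section GeneratedAlgebra.
Variables (R : realType) (T : pointedType) (B : cstarAlgType R).
Implicit Types f g : T -> B.

Definition bounded_cstar : fun_cstar T B := FunCStar (fun _ bf => bf)
  (@bounded_one R T B) (@bounded_lin R T B) (@bounded_mul R T B) (@bounded_star R T B)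
  (@bounded_lim R T B).

Variable G : set (T -> B).
Hypothesis G_bounded : forall g, G g -> bounded_fct g.

(** The closed *-algebra generated by [G], as an intersection; this form makes
    induction on its elements an application to a suitable closed *-algebra. *)
Definition generated f : Prop :=
  forall S : fun_cstar T B, (forall g, G g -> S g) -> S f.

Lemma generated_bounded f : generated f -> bounded_fct f.
Proof. by move=> /(_ bounded_cstar); apply. Qed.

Lemma generated_one : generated 1.
Proof. by move=> S _; exact: fc_one. Qed.

Lemma generated_lin (c : R[i]) f g : generated f -> generated g -> generated (c *: f + g).
Proof. by move=> Gf Gg S GS; apply: fc_lin; [exact: Gf|exact: Gg]. Qed.

Lemma generated_mul f g : generated f -> generated g -> generated (f * g).
Proof. by move=> Gf Gg S GS; apply: fc_mul; [exact: Gf|exact: Gg]. Qed.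

Lemma generated_star f : generated f -> generated (star f).
Proof. by move=> Gf S GS; apply: fc_star; exact: Gf. Qed.

Lemma generated_lim f :
  (forall e, 0 < e -> exists2 g, generated g & forall t, cnorm (f t - g t) <= e) ->
  generated f.
Proof.
move=> happrox S GS; apply: fc_lim => e /happrox[g Gg fg].
by exists g => //; exact: Gg.
Qed.

Definition gen_cstar : fun_cstar T B := FunCStar generated_bounded
  generated_one generated_lin generated_mul generated_star generated_lim.

Lemma generated_gen g : G g -> gen_cstar g.
Proof. by move=> Gg S; exact. Qed.

End GeneratedAlgebra.

(** A path [r] of maps between index sets transports functions by [a |-> a \o r t].
    The functions whose transport is a norm-continuous path in [S] form again a
    closed *-algebra; thus it suffices to transport generators, and this single
    principle yields the rotations of the concrete algebra as well as its map
    into the twisted join. *)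
Section Transport.
Variables (R : realType) (T T' : pointedType) (B : cstarAlgType R).
Variables (S : fun_cstar T B) (r : unit_interval R -> T -> T').

Definition transport_along (a : T' -> B) (f : unit_interval R -> fc_alg S) :=
  path_set f /\ forall t y, fc_val (f t) y = a (r t y).

Definition transported (a : T' -> B) := bounded_fct a /\ exists f, transport_along a f.

Lemma transported_bounded a : transported a -> bounded_fct a.
Proof. by case. Qed.

Lemma transported_one : transported 1.
Proof.
split; first exact: bounded_one.
by exists (fun=> 1); split; [exact: path_cst|move=> t y; exact: fc_eval1].
Qed.

Lemma transported_lin (c : R[i]) a b :
  transported a -> transported b -> transported (c *: a + b).
Proof.
move=> [ba [f [pf fa]]] [bb [g [pg gb]]]; split; first exact: bounded_lin.
exists (c *: f + g); split=> [|t y]; first exact: path_lin.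
by rewrite fc_evalD fc_evalZ fa gb.
Qed.

Lemma transported_mul a b : transported a -> transported b -> transported (a * b).
Proof.
move=> [ba [f [pf fa]]] [bb [g [pg gb]]]; split; first exact: bounded_mul.
exists (f * g); split=> [|t y]; first exact: path_mul.
by rewrite fc_evalM fa gb.
Qed.

Lemma transported_star a : transported a -> transported (star a).
Proof.
move=> [ba [f [pf fa]]]; split; first exact: bounded_star.
exists (star f); split=> [|t y]; first exact: path_star.
by rewrite -[RHS]/(star (a (r t y))) -fa.
Qed.

Lemma transported_lim a :
  (forall e, 0 < e -> exists2 b, transported b & forall t, cnorm (a t - b t) <= e) ->
  transported a.
Proof.
move=> happrox; split.
  by apply: bounded_lim => e /happrox[b [bb _] ab]; exists b.
have Sa t : S (a \o r t).
  apply: fc_lim => e /happrox[b [_ [f [_ fb]]] ab].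
  exists (fc_val (f t)) => [|y]; first exact: fc_inP.
  by rewrite fb /= ab.
exists (fun t => to_fc (Sa t)); split=> //.
apply: path_lim => e /happrox[b [_ [f [pf fb]]] ab].
exists f => // t; apply: sup_norm_le => y.
by rewrite fc_evalD fc_evalN fb /= ab.
Qed.

Definition transport_cstar : fun_cstar T' B := FunCStar transported_bounded
  transported_one transported_lin transported_mul transported_star transported_lim.

Variables (G : set (T' -> B)) (Gb : forall g, G g -> bounded_fct g).
Hypothesis transport_gen : forall g, G g -> exists f, transport_along g f.
Local Notation A := (fc_alg (gen_cstar Gb)).

Lemma transport_all (a : A) : exists f, transport_along (fc_val a) f.
Proof.
have : transport_cstar (fc_val a).
  by apply: (fc_inP a) => g Gg; split; [exact: Gb|exact: transport_gen].
by case.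
Qed.

Definition transport (t : unit_interval R) (a : A) : fc_alg S :=
  sval (cid (transport_all a)) t.

Lemma transportE t a y : fc_val (transport t a) y = fc_val a (r t y).
Proof. by rewrite /transport; case: cid => f []. Qed.

Lemma transport_continuous a :
  continuous ((fun t => transport t a) : _ -> normed_space (fc_alg S)).
Proof. by rewrite /transport; case: cid => f [[]]. Qed.

Lemma transport_hom t : star_hom (transport t).
Proof.
split=> [c a b|| a].
- by apply: fc_ext => y; rewrite fc_evalD fc_evalZ !transportE fc_evalD fc_evalZ.
- split=> [|a b]; apply: fc_ext => y.
    by rewrite transportE !fc_eval1.
  by rewrite fc_evalM !transportE fc_evalM.
- apply: fc_ext => y; rewrite transportE.
  by rewrite -[LHS]/(star (fc_val a (r t y))) -transportE.
Qed.

End Transport.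

(** * Self-adjoint traceless 2 x 2 matrices *)

Section TracelessMatrices.
Variable R : realType.
Local Notation C := R[i].
Local Notation D := 'M[C]_2.

(** Self-adjoint traceless matrices correspond to vectors of the Euclidean
    3-space. *)
Definition pauli (w : 'rV[R]_3) : D := \matrix_(i, j)
  if i == 0 then if j == 0 then (w 0 0)%:C else w 0 1 +i* w 0 2%:R
  else if j == 0 then w 0 1 -i* w 0 2%:R else - (w 0 0)%:C.

Definition dot3 (w z : 'rV[R]_3) : R := w 0 0 * z 0 0 + w 0 1 * z 0 1 + w 0 2%:R * z 0 2%:R.

Lemma pauli_anticomm w z :
  pauli w * pauli z + pauli z * pauli w = (2 * dot3 w z)%:C *: 1.
Proof.
apply/matrixP => i j; rewrite !mxE !sum2 /dot3.
have [->|->] := I2P i; have [->|->] := I2P j; rewrite !mxE /=;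
  by apply/eqP; rewrite eq_complex /=; apply/andP; split; apply/eqP; ring.
Qed.

Lemma pauli_sqr w : pauli w * pauli w = (dot3 w w)%:C *: 1.
Proof.
have two0 : (2 : C) != 0 by rewrite pnatr_eq0.
apply: (scalerI two0); rewrite scaler_nat mulr2n pauli_anticomm scalerA.
by rewrite rmorphM /= rmorph_nat.
Qed.

Lemma star_pauli w : star (pauli w) = pauli w.
Proof.
apply/matrixP => i j; rewrite !mxE.
have [->|->] := I2P i; have [->|->] := I2P j; rewrite /=;
  by apply/eqP; rewrite eq_complex /= ?oppr0 ?opprK !eqxx.
Qed.

Lemma trace_pauli w : \tr (pauli w) = 0.
Proof. by rewrite /mxtrace sum2 !mxE /= subrr. Qed.

Lemma pauli_surj (u : D) : star u = u -> \tr u = 0 -> exists w, u = pauli w.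
Proof.
move=> su; rewrite /mxtrace sum2 => /eqP; rewrite addr_eq0 => /eqP tu.
pose w : 'rV[R]_3 := \row_k (if k == 0 then complex.Re (u 0 0)
  else if k == 1 then complex.Re (u 0 1) else complex.Im (u 0 1)).
have adj i j : u i j = Num.conj (u j i) by rewrite -{1}su !mxE.
exists w; apply/matrixP => i j.
have d0 : u 0 0 = (complex.Re (u 0 0))%:C.
  have := adj 0 0; case: (u 0 0) => a b [] /eqP.
  by rewrite -addr_eq0 -mulr2n mulrn_eq0 /= => /eqP ->.
have [->|->] := I2P i; have [->|->] := I2P j; rewrite !mxE /=.
- by rewrite {1}d0.
- by case: (u 0 1).
- by rewrite adj; case: (u 0 1).
- by rewrite -d0 tu opprK.
Qed.

Lemma dot3_ge0 w : 0 <= dot3 w w.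
Proof. by rewrite /dot3 -!expr2 !addr_ge0 ?sqr_ge0. Qed.

Lemma dot3_gt0 w : w != 0 -> 0 < dot3 w w.
Proof.
move=> w0; rewrite lt_neqAle dot3_ge0 andbT eq_sym; apply: contra w0.
rewrite /dot3 -!expr2 !paddr_eq0 ?addr_ge0 ?sqr_ge0 // !sqrf_eq0.
move=> /andP[/andP[/eqP w0 /eqP w1] /eqP w2]; apply/eqP/rowP => k; rewrite mxE.
by case: k => -[|[|[|//]]] i; [rewrite -[RHS]w0|rewrite -[RHS]w1|rewrite -[RHS]w2];
  congr (w _ _); apply/val_inj.
Qed.

(** Two linear equations in three unknowns have a nonzero solution. *)
Lemma orthogonal_vector (w z : 'rV[R]_3) :
  exists m, [/\ dot3 m m = 1, dot3 m w = 0 & dot3 m z = 0].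
Proof.
pose N := row_mx w^T z^T.
have /rowV0Pn[k /sub_kermxP kN k0] : kermx N != 0.
  rewrite -mxrank_eq0 mxrank_ker subn_eq0 -ltnNge.
  exact: leq_ltn_trans (rank_leq_col N) _.
have dotE (a : 'rV[R]_3) : (k *m a^T) 0 0 = dot3 k a.
  rewrite mxE !big_ord_recl big_ord0 addr0 !mxE /dot3 addrA.
  by congr (_ * _ + k _ _ * a _ _ + k _ _ * a _ _); apply/val_inj.
have := kN; rewrite mul_mx_row -[0]row_mx0 => /eq_row_mx[kw kz].
have dw : dot3 k w = 0 by rewrite -dotE kw mxE.
have dz : dot3 k z = 0 by rewrite -dotE kz mxE.
have dotZ c a b : dot3 (c *: a) b = c * dot3 a b by rewrite /dot3 !mxE; ring.
have dotC a b : dot3 a b = dot3 b a by rewrite /dot3; ring.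
have kk := dot3_gt0 k0.
exists ((Num.sqrt (dot3 k k))^-1 *: k); rewrite !dotZ dw dz mulr0; split=> //.
rewrite dotC dotZ mulrA -invfM -expr2 sqr_sqrtr ?ltW // mulVf //.
by rewrite gt_eqF.
Qed.

(** A unit vector orthogonal to those of [u] and [v] gives a unit that
    anticommutes with both. *)
Lemma exists_anticommuting_unit (u v : D) :
  star u = u -> star v = v -> \tr u = 0 -> \tr v = 0 ->
  exists m : D, [/\ star m = m, \tr m = 0, m * m = 1, m * u = - (u * m)
    & m * v = - (v * m)].
Proof.
move=> su sv tu tv; have [w ->] := pauli_surj su tu; have [z ->] := pauli_surj sv tv.
have [k [kk kw kz]] := orthogonal_vector w z; exists (pauli k); split.
- exact: star_pauli.
- exact: trace_pauli.
- by rewrite pauli_sqr kk scale1r.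
- by apply/eqP; rewrite -addr_eq0 pauli_anticomm kw mulr0 scale0r.
- by apply/eqP; rewrite -addr_eq0 pauli_anticomm kz mulr0 scale0r.
Qed.

(** Squares of self-adjoint traceless matrices are nonnegative scalars. *)
Lemma circle_relations_norm (u v : D) : circle_relations u v ->
  \tr u = 0 -> \tr v = 0 -> cnorm u <= 1 /\ cnorm v <= 1.
Proof.
move=> [su sv]; rewrite !expr2 => uv tu tv.
have sqr_norm w : cnorm (pauli w) ^+ 2 = dot3 w w.
  rewrite -cnorm_starM star_pauli pauli_sqr cnormZ cnorm1 mulr1.
  by apply/complexI; rewrite -normcE ger0_norm // lecR dot3_ge0.
have [w uE] := pauli_surj su tu; have [z vE] := pauli_surj sv tv.
have : dot3 w w + dot3 z z = 1.
  apply/complexI; move: uv; rewrite uE vE !pauli_sqr -scalerDl -rmorphD.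
  by move=> /matrixP/(_ 0 0); rewrite !mxE /= mulr1.
rewrite -!sqr_norm -uE -vE => uv1.
split; rewrite -(ler_sqr (cnorm_ge0 _)) ?nnegrE // expr1n -uv1.
  by rewrite lerDl sqr_ge0.
by rewrite lerDr sqr_ge0.
Qed.

End TracelessMatrices.

(** * The concrete algebra *)

Section SpinModel.
Variable R : realType.
Local Notation C := R[i].
Local Notation D := 'M[C]_2.

(** The concrete algebra consists of functions on the pairs of self-adjoint
    traceless 2 x 2 matrices satisfying the circle relations. This index set is
    chosen because it is stable under the operations of the proof: with a unit
    [m] as in [join_pt], the pair [(s u + c m, s v)] is again traceless. *)
Record circle_pt := CirclePt {
  pt_u : D; pt_v : D;
  pt_rel : circle_relations pt_u pt_v;
  pt_tr : \tr pt_u = 0 /\ \tr pt_v = 0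
}.

(** Functions on these triples contain the crossed product, [jp_m] being its
    unitary. *)
Record join_pt := JoinPt {
  jp_base : circle_pt; jp_m : D;
  jp_unit : star jp_m = jp_m /\ jp_m * jp_m = 1;
  jp_tr : \tr jp_m = 0;
  jp_anti : jp_m * pt_u jp_base = - (pt_u jp_base * jp_m) /\
            jp_m * pt_v jp_base = - (pt_v jp_base * jp_m)
}.

HB.instance Definition _ := gen_eqMixin circle_pt.
HB.instance Definition _ := gen_choiceMixin circle_pt.
HB.instance Definition _ := gen_eqMixin join_pt.
HB.instance Definition _ := gen_choiceMixin join_pt.

Lemma circle_pt_eq (p q : circle_pt) : pt_u p = pt_u q -> pt_v p = pt_v q -> p = q.
Proof.
case: p q => u v r t [u' v' r' t'] /= uE vE; case: _ / uE in r' t' *.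
by case: _ / vE in r' t' *; congr CirclePt; exact: Prop_irrelevance.
Qed.

Lemma mxtrace_opp (a : D) : \tr (- a) = - \tr a.
Proof. by rewrite raddfN. Qed.

(** Functions of [(u, v)] thereby embed, with their norms, into the functions of
    [(u, v, m)]. *)
Lemma join_pt_exists (p : circle_pt) : exists q : join_pt, jp_base q = p.
Proof.
have [su sv _] := pt_rel p; have [tu tv] := pt_tr p.
have [m [sm tm m2 mu mv]] := exists_anticommuting_unit su sv tu tv.
by exists (@JoinPt p m (conj sm m2) tm (conj mu mv)).
Qed.

Lemma jp_mK q : jp_m q * jp_m q = 1.
Proof. by have [] := jp_unit q. Qed.

Lemma star_jp_m q : star (jp_m q) = jp_m q.
Proof. by have [] := jp_unit q. Qed.

Definition join_over (p : circle_pt) : join_pt := sval (cid (join_pt_exists p)).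

Lemma join_overK p : jp_base (join_over p) = p.
Proof. by rewrite /join_over; case: cid. Qed.

Lemma unit_pt_proof (m : D) : star m = m /\ m * m = 1 -> \tr m = 0 ->
  circle_relations m 0 /\ (\tr m = 0 /\ \tr (0 : D) = 0).
Proof.
move=> [sm m2] tm; split; last by rewrite mxtrace0.
have [_ s0 _] := @circle_relations10 R D.
by split=> //; rewrite expr0n addr0 expr2.
Qed.

Definition unit_pt (m : D) (h : star m = m /\ m * m = 1) (t : \tr m = 0) : circle_pt :=
  CirclePt (unit_pt_proof h t).1 (unit_pt_proof h t).2.

Lemma pauli_e0_unit : let m := pauli (\row_k (k == 0)%:R : 'rV[R]_3) in
  star m = m /\ m * m = 1.
Proof.
split; first exact: star_pauli.
by rewrite pauli_sqr /dot3 !mxE /= !mulr0 mulr1 !addr0 scale1r.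
Qed.

Definition circle_pt0 : circle_pt := unit_pt pauli_e0_unit (trace_pauli _).

HB.instance Definition _ := isPointed.Build circle_pt circle_pt0.
HB.instance Definition _ := isPointed.Build join_pt (join_over circle_pt0).

Definition neg_pt (p : circle_pt) : circle_pt.
Proof.
apply: (@CirclePt (- pt_u p) (- pt_v p)).
  exact: circle_relationsN (pt_rel p).
by rewrite !mxtrace_opp; have [-> ->] := pt_tr p; rewrite oppr0.
Defined.

Definition rot_pt (c s : R) (cs : c ^+ 2 + s ^+ 2 = 1) (p : circle_pt) : circle_pt.
Proof.
apply: (@CirclePt (c%:C *: pt_u p + s%:C *: pt_v p) (- s%:C *: pt_u p + c%:C *: pt_v p)).
  exact: circle_relations_rot cs (pt_rel p).
by rewrite !mxtraceD !mxtraceZ; have [-> ->] := pt_tr p; rewrite !mulr0 addr0.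
Defined.

Definition join_map (c s : R) (cs : c ^+ 2 + s ^+ 2 = 1) (q : join_pt) : circle_pt.
Proof.
apply: (@CirclePt (s%:C *: pt_u (jp_base q) + c%:C *: jp_m q) (s%:C *: pt_v (jp_base q))).
  apply: circle_relations_join cs _ _ (jp_anti q).1 (pt_rel _); first exact: (jp_unit q).1.
  by rewrite expr2 (jp_unit q).2.
rewrite !mxtraceD !mxtraceZ jp_tr; have [-> ->] := pt_tr (jp_base q).
by rewrite !mulr0 addr0.
Defined.

Definition flip_pt (q : join_pt) : join_pt.
Proof.
apply: (@JoinPt (jp_base q) (- jp_m q)).
- by rewrite starN mulrNN star_jp_m jp_mK.
- by rewrite mxtrace_opp jp_tr oppr0.
- by rewrite !mulNr !mulrN; have [-> ->] := jp_anti q.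
Defined.

Definition neg_join_pt (q : join_pt) : join_pt.
Proof.
apply: (@JoinPt (neg_pt (jp_base q)) (- jp_m q)).
- by rewrite starN mulrNN star_jp_m jp_mK.
- by rewrite mxtrace_opp jp_tr oppr0.
- by rewrite /= !mulrNN; exact: jp_anti.
Defined.

Lemma neg_ptK : involutive neg_pt.
Proof. by move=> p; apply: circle_pt_eq; rewrite /= opprK. Qed.

Lemma cnorm_pt_u p : cnorm (pt_u p) <= 1.
Proof. by have [] := circle_relations_norm (pt_rel p) (pt_tr p).1 (pt_tr p).2. Qed.

Lemma cnorm_pt_v p : cnorm (pt_v p) <= 1.
Proof. by have [] := circle_relations_norm (pt_rel p) (pt_tr p).1 (pt_tr p).2. Qed.

Lemma cnorm_jp_m q : cnorm (jp_m q) = 1.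
Proof.
apply/eqP; rewrite -(eqrXn2 (ltn0Sn 1) (cnorm_ge0 _) ler01) -cnorm_starM.
by rewrite star_jp_m jp_mK cnorm1 expr1n.
Qed.

Definition coords : set (circle_pt -> D) := [set a | a = pt_u \/ a = pt_v].

Lemma coords_bounded a : coords a -> bounded_fct a.
Proof. by move=> [->|->]; exists 1 => p; rewrite ?cnorm_pt_u ?cnorm_pt_v. Qed.

Definition spin_cstar : fun_cstar circle_pt D := gen_cstar coords_bounded.
Local Notation A := (fc_alg spin_cstar).

Definition spin_x : A :=
  to_fc (S := spin_cstar) (generated_gen coords_bounded (or_introl erefl)).
Definition spin_y : A :=
  to_fc (S := spin_cstar) (generated_gen coords_bounded (or_intror erefl)).

Lemma spin_relations : circle_relations spin_x spin_y.
Proof. by apply: fc_relations => p; exact: pt_rel. Qed.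

End SpinModel.

(** * Rotations and the antipodal automorphism *)

Section SpinAction.
Variable R : realType.
Local Notation C := R[i].
Local Notation D := 'M[C]_2.
Local Notation A := (fc_alg (spin_cstar R)).

Lemma path_angleN (a b : R) t : path_angle (- a) (- b) t = - path_angle a b t.
Proof. by rewrite /path_angle mulNr -opprD. Qed.

Definition rot_path (a b : R) (t : unit_interval R) : circle_pt R -> circle_pt R :=
  rot_pt (cos2Dsin2 (path_angle a b t)).

Lemma rot_pathK a b t : cancel (rot_path a b t) (rot_path (- a) (- b) t).
Proof.
move=> p; have [ru rv] := rotation_inverse (pt_u p) (pt_v p) (cos2Dsin2 (path_angle a b t)).
apply: circle_pt_eq; rewrite /= path_angleN cosN sinN rmorphN.
  by rewrite scaleNr.
by rewrite opprK.
Qed.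

Lemma rot_path_gen a b g : coords g ->
  exists f : unit_interval R -> A, transport_along (rot_path a b) g f.
Proof.
pose th := path_angle a b.
case=> ->.
  exists (fun t => (cos (th t))%:C *: spin_x R + (sin (th t))%:C *: spin_y R).
  by split=> //; apply: path_add; [exact: path_cos|exact: path_sin].
exists (fun t => (sin (th t))%:C *: - spin_x R + (cos (th t))%:C *: spin_y R).
split; first by apply: path_add; [exact: path_sin|exact: path_cos].
by move=> t p; rewrite fc_evalD !fc_evalZ fc_evalN scalerN -scaleNr.
Qed.

Definition spin_rot a b t : A -> A :=
  transport (rot_path_gen a b) t.

Lemma spin_rotK a b t : cancel (spin_rot (- a) (- b) t) (spin_rot a b t).
Proof. by move=> e; apply: fc_ext => p; rewrite !transportE rot_pathK. Qed.

(** The start of the path of rotations through [pi (1 - t)]. *)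
Definition spin_antipode : A -> A := spin_rot (- pi) pi (itv0 R).

Lemma spin_antipodeE a p : fc_val (spin_antipode a) p = fc_val a (neg_pt p).
Proof.
rewrite transportE; congr (fc_val a _); apply: circle_pt_eq => /=;
  rewrite path_angle0 cospi sinpi rmorphN rmorph1 rmorph0.
  by rewrite scale0r addr0 scaleN1r.
by rewrite oppr0 scale0r add0r scaleN1r.
Qed.

Lemma spin_antipode_hom : star_hom spin_antipode.
Proof. exact: transport_hom. Qed.

Lemma spin_antipodeK : involutive spin_antipode.
Proof. by move=> a; apply: fc_ext => p; rewrite !spin_antipodeE neg_ptK. Qed.

Lemma spin_antipode_x : spin_antipode (spin_x R) = - spin_x R.
Proof. by apply: fc_ext => p; rewrite spin_antipodeE fc_evalN. Qed.

Lemma spin_antipode_y : spin_antipode (spin_y R) = - spin_y R.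
Proof. by apply: fc_ext => p; rewrite spin_antipodeE fc_evalN. Qed.

Lemma spin_antipode_connected : connected_to_id spin_antipode.
Proof.
apply: (@connected_to_id_path _ _ (spin_rot (- pi) pi)) => [a|t|].
- exact: transport_continuous.
- split; first exact: transport_hom.
  exists (spin_rot (- - pi) (- pi) t); last exact: spin_rotK.
  by move=> e; have := @spin_rotK (- - pi) (- pi) t e; rewrite !opprK.
- apply/funext => a; apply: fc_ext => p; rewrite transportE; congr (fc_val a _).
  apply: circle_pt_eq => /=; rewrite path_angle1 addNr cos0 sin0 rmorph1 rmorph0.
    by rewrite scale0r addr0 scale1r.
  by rewrite oppr0 scale0r add0r scale1r.
Qed.

(** Conjugation by the unit over a point is the antipodal map: this holds for the
    coordinates, hence for all of the algebra. *)
Section Covariance.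

Definition covariant (f : circle_pt R -> D) := bounded_fct f /\
  forall q, jp_m q * f (jp_base q) = f (neg_pt (jp_base q)) * jp_m q.

Lemma covariant_bounded f : covariant f -> bounded_fct f.
Proof. by case. Qed.

Lemma covariant_one : covariant 1.
Proof. by split=> [|q]; [exact: bounded_one|rewrite mulr1 mul1r]. Qed.

Lemma covariant_lin (c : C) f g : covariant f -> covariant g -> covariant (c *: f + g).
Proof.
move=> [bf cf] [bg cg]; split=> [|q]; first exact: bounded_lin.
by rewrite mulrDr mulrDl -scalerAr -scalerAl cf cg.
Qed.

Lemma covariant_mul f g : covariant f -> covariant g -> covariant (f * g).
Proof.
move=> [bf cf] [bg cg]; split=> [|q]; first exact: bounded_mul.
by rewrite -mulrA -cg !mulrA cf.
Qed.

Lemma covariant_star f : covariant f -> covariant (star f).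
Proof.
move=> [bf cf]; split=> [|q]; first exact: bounded_star.
(* The covariance of [f], multiplied by [m] on both sides. *)
have h : f (jp_base q) * jp_m q = jp_m q * f (neg_pt (jp_base q)).
  by rewrite -[LHS]mul1r -(jp_mK q) -!mulrA (mulrA _ _ (jp_m q)) cf -!mulrA jp_mK mulr1.
by apply: (can_inj (@starK _ _)); rewrite !starM !star_jp_m /= !starK h.
Qed.

Lemma covariant_lim f :
  (forall e, 0 < e -> exists2 g, covariant g & forall t, cnorm (f t - g t) <= e) ->
  covariant f.
Proof.
move=> happrox; split.
  by apply: bounded_lim => e /happrox[g [bg _] fg]; exists g.
move=> q; apply: cnorm_approx_eq => e e0.
have [g [_ cg] fg] := happrox _ (divr_gt0 e0 (ltr0Sn _ 1)).
have -> : jp_m q * f (jp_base q) - f (neg_pt (jp_base q)) * jp_m q =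
    jp_m q * (f (jp_base q) - g (jp_base q)) -
    (f (neg_pt (jp_base q)) - g (neg_pt (jp_base q))) * jp_m q.
  by rewrite mulrBr mulrBl cg opprB addrA subrK.
apply: le_trans (cnormB _ _) _; rewrite (splitr e).
by apply: lerD; apply: le_trans (cnormM _ _) _; rewrite cnorm_jp_m ?mul1r ?mulr1 fg.
Qed.

Definition covariant_cstar : fun_cstar (circle_pt R) D := FunCStar covariant_bounded
  covariant_one covariant_lin covariant_mul covariant_star covariant_lim.

Lemma spin_covariant (a : A) q :
  jp_m q * fc_val a (jp_base q) = fc_val (spin_antipode a) (jp_base q) * jp_m q.
Proof.
rewrite spin_antipodeE; have : covariant_cstar (fc_val a).
  apply: (fc_inP a) => g gc; split; first exact: coords_bounded gc.
  by case: gc => -> r; have [hu hv] := jp_anti r; rewrite /= mulNr ?hu ?hv.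
by case.
Qed.

End Covariance.

End SpinAction.

(** * The crossed product of the concrete algebra *)

Section SpinCrossedProduct.
Variable R : realType.
Local Notation C := R[i].
Local Notation D := 'M[C]_2.
Local Notation A := (fc_alg (spin_cstar R)).
Local Notation tau := (@spin_antipode R).
Implicit Types (F G : join_pt R -> D) (a b : A) (q : join_pt R).

Definition combination a0 a1 F :=
  forall q, F q = fc_val a0 (jp_base q) + fc_val a1 (jp_base q) * jp_m q.

Definition join_set F := exists a0 a1, combination a0 a1 F.

Let half_double (z : D) : 2^-1 *: (z + z) = z.
Proof. by rewrite -mulr2n -[z *+ 2]scaler_nat scalerA mulVf ?scale1r // pnatr_eq0. Qed.

(** Changing the sign of [m] separates the two coefficients. *)
Lemma combination_even a0 a1 F q : combination a0 a1 F ->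
  fc_val a0 (jp_base q) = 2^-1 *: (F q + F (flip_pt q)).
Proof.
by move=> Fa; rewrite !Fa /= mulrN addrACA subrr addr0 half_double.
Qed.

Lemma combination_odd a0 a1 F q : combination a0 a1 F ->
  fc_val a1 (jp_base q) = 2^-1 *: ((F q - F (flip_pt q)) * jp_m q).
Proof.
move=> Fa; rewrite !Fa /= mulrN opprD opprK addrACA subrr add0r.
by rewrite mulrDl -!mulrA jp_mK mulr1 half_double.
Qed.

Lemma join_bounded F : join_set F -> bounded_fct F.
Proof.
move=> [a0 [a1 Fa]]; exists (cnorm a0 + cnorm a1) => q; rewrite Fa.
apply: le_trans (cnormD _ _) _; rewrite lerD ?fc_norm_ub //.
by apply: le_trans (cnormM _ _) _; rewrite cnorm_jp_m mulr1 fc_norm_ub.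
Qed.

Lemma join_one : join_set 1.
Proof. by exists 1, 0 => q; rewrite fc_eval1 mul0r addr0. Qed.

Lemma join_lin (c : C) F G : join_set F -> join_set G -> join_set (c *: F + G).
Proof.
move=> [a0 [a1 Fa]] [b0 [b1 Gb]]; exists (c *: a0 + b0), (c *: a1 + b1) => q.
rewrite -[LHS]/(c *: F q + G q) Fa Gb !fc_evalD !fc_evalZ mulrDl scalerDr -scalerAl.
by rewrite addrACA.
Qed.

Lemma join_mul F G : join_set F -> join_set G -> join_set (F * G).
Proof.
move=> [a0 [a1 Fa]] [b0 [b1 Gb]].
exists (a0 * b0 + a1 * tau b1), (a0 * b1 + a1 * tau b0) => q.
rewrite -[LHS]/(F q * G q) Fa Gb !fc_evalD !fc_evalM mulrDl !mulrDr !mulrDl.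
have swap b : fc_val a1 (jp_base q) * jp_m q * fc_val b (jp_base q) =
    fc_val a1 (jp_base q) * fc_val (tau b) (jp_base q) * jp_m q.
  by rewrite -!mulrA -spin_covariant.
rewrite !(mulrA (_ * jp_m q)) !swap -(mulrA _ (jp_m q)) jp_mK mulr1 !mulrA.
by rewrite -!addrA; congr (_ + _); rewrite addrA addrC.
Qed.

Lemma join_star F : join_set F -> join_set (star F).
Proof.
move=> [a0 [a1 Fa]]; exists (star a0), (tau (star a1)) => q.
rewrite -spin_covariant -[LHS]/(star (F q)) Fa starD starM.
by rewrite star_jp_m.
Qed.

(** The coefficients of the approximants converge, being recovered from their
    values at [m] and [- m]; the limit coefficients are computed along a choice
    of a unit over each point. *)
Lemma join_lim F :
  (forall e, 0 < e -> exists2 G, join_set G & forall q, cnorm (F q - G q) <= e) ->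
  join_set F.
Proof.
move=> happrox.
pose f0 p : D := 2^-1 *: (F (join_over p) + F (flip_pt (join_over p))).
pose f1 p : D := 2^-1 *: ((F (join_over p) - F (flip_pt (join_over p))) * jp_m (join_over p)).
have half (z : D) e : cnorm z <= e + e -> cnorm (2^-1 *: z) <= e.
  by rewrite cnormZ normc2V ler_pdivrMl // mulr_natl mulr2n.
have approx e : 0 < e -> exists a0 a1, [/\
    forall q, cnorm (F q - (fc_val a0 (jp_base q) + fc_val a1 (jp_base q) * jp_m q)) <= e,
    forall p, cnorm (f0 p - fc_val a0 p) <= e & forall p, cnorm (f1 p - fc_val a1 p) <= e].
  move=> /happrox[G [a0 [a1 Ga]] FG]; exists a0, a1; split=> [q|p|p].
  - by rewrite -Ga.
  - rewrite -{2}(join_overK p) (combination_even _ Ga) /f0 -scalerBr opprD addrACA.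
    by apply: half; apply: le_trans (cnormD _ _) _; rewrite lerD.
  - rewrite -{2}(join_overK p) (combination_odd _ Ga) /f1 -scalerBr -mulrBl.
    apply: half; apply: le_trans (cnormM _ _) _; rewrite cnorm_jp_m mulr1.
    rewrite opprD opprK addrACA; apply: le_trans (cnormD _ _) _.
    by rewrite lerD // addrC cnormBC.
have Sf0 : spin_cstar R f0.
  apply: fc_lim => e /approx[a0 [a1 [_ h _]]].
  by exists (fc_val a0) => //; exact: fc_inP.
have Sf1 : spin_cstar R f1.
  apply: fc_lim => e /approx[a0 [a1 [_ _ h]]].
  by exists (fc_val a1) => //; exact: fc_inP.
exists (to_fc Sf0), (to_fc Sf1) => q; apply: cnorm_approx_eq => e e0.
have [a0 [a1 [hF h0 h1]]] := approx _ (divr_gt0 e0 (ltr0Sn _ 2)).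
set z0 := fc_val a0 (jp_base q); set z1 := fc_val a1 (jp_base q).
apply: le_trans (cnorm_triangle _ (z0 + z1 * jp_m q) _) _.
have -> : e = e / 3 + (e / 3 + e / 3) by field.
apply: lerD; first exact: hF.
rewrite /= opprD addrACA -mulrBl.
apply: le_trans (cnormD _ _) _; apply: lerD; first by rewrite cnormBC h0.
by apply: le_trans (cnormM _ _) _; rewrite cnorm_jp_m mulr1 cnormBC h1.
Qed.

Definition join_cstar : fun_cstar (join_pt R) D := FunCStar join_bounded
  join_one join_lin join_mul join_star join_lim.
Local Notation X := (fc_alg join_cstar).

Lemma join_set_inj a : join_set (fun q => fc_val a (jp_base q)).
Proof. by exists a, 0 => q; rewrite mul0r addr0. Qed.

Lemma join_set_mu : join_set (@jp_m R).
Proof. by exists 0, 1 => q; rewrite fc_eval1 mul1r add0r. Qed.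

Definition spin_inj a : X := to_fc (S := join_cstar) (join_set_inj a).
Definition spin_mu : X := to_fc (S := join_cstar) join_set_mu.

Lemma spin_coef_exists (F : X) : exists a : 'I_2 -> A, combination (a 0) (a 1) (fc_val F).
Proof.
have [a0 [a1 Fa]] := fc_inP F.
by exists (fun j => if j == 0 then a0 else a1).
Qed.

Definition spin_coef (F : X) : 'I_2 -> A := sval (cid (spin_coef_exists F)).

Lemma spin_coefP (F : X) : combination (spin_coef F 0) (spin_coef F 1) (fc_val F).
Proof. by rewrite /spin_coef; case: cid. Qed.

Lemma combination_unique a0 a1 b0 b1 F :
  combination a0 a1 F -> combination b0 b1 F -> a0 = b0 /\ a1 = b1.
Proof.
move=> Fa Fb; split; apply: fc_ext => p; rewrite -(join_overK p).
  by rewrite (combination_even _ Fa) (combination_even _ Fb).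
by rewrite (combination_odd _ Fa) (combination_odd _ Fb).
Qed.

Lemma combination_pair a0 a1 :
  combination a0 a1 (fc_val (spin_inj a0 + spin_inj a1 * spin_mu)).
Proof. by move=> q; rewrite fc_evalD fc_evalM. Qed.

Lemma sum2_mu (a : 'I_2 -> A) : \sum_(j < 2) spin_inj (a j) * spin_mu ^+ j =
  spin_inj (a 0) + spin_inj (a 1) * spin_mu.
Proof. by rewrite sum2 expr0 mulr1 expr1. Qed.

Lemma spin_inj_hom : star_hom spin_inj.
Proof. by split=> [c a b||a]; [exact: fc_ext|split|]; try move=> *; exact: fc_ext. Qed.

Lemma spin_mu_unitary : star spin_mu * spin_mu = 1 /\ spin_mu * star spin_mu = 1.
Proof.
have -> : star spin_mu = spin_mu by apply: fc_ext => q; exact: star_jp_m.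
by split; apply: fc_ext => q; rewrite fc_evalM fc_eval1 jp_mK.
Qed.

Lemma spin_mu_order : spin_mu ^+ 2 = 1.
Proof. by apply: fc_ext => q; rewrite expr2 fc_evalM fc_eval1 jp_mK. Qed.

Lemma spin_mu_covariant a :
  spin_mu * spin_inj a * star spin_mu = spin_inj (iter_action tau 1 a).
Proof.
apply: fc_ext => q; rewrite !fc_evalM.
have -> : fc_val (star spin_mu) q = jp_m q by exact: star_jp_m.
by rewrite /= spin_covariant -mulrA jp_mK mulr1.
Qed.

Lemma spin_expand (F : X) : F = \sum_(j < 2) spin_inj (spin_coef F j) * spin_mu ^+ j.
Proof.
by apply: fc_ext => q; rewrite sum2_mu (spin_coefP F) (combination_pair _ _ q).
Qed.

Lemma spin_unique (a : 'I_2 -> A) :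
  spin_coef (\sum_(j < 2) spin_inj (a j) * spin_mu ^+ j) =1 a.
Proof.
have [h0 h1] := combination_unique
  (spin_coefP (\sum_(j < 2) spin_inj (a j) * spin_mu ^+ j)) 
  (eq_ind_r (fun F : X => combination (a 0) (a 1) (fc_val F)) (combination_pair _ _) (sum2_mu a)).
by move=> j; have [->|->] := I2P j.
Qed.

Definition spin_crossed_product : crossed_product (iter_action tau) :=
  @CrossedProduct R A 2 (iter_action tau) X spin_inj spin_mu spin_coef
    spin_inj_hom spin_mu_unitary spin_mu_order spin_mu_covariant spin_expand spin_unique.

End SpinCrossedProduct.

(** * The equivariant map of the concrete algebra *)

Section SpinJoin.
Variable R : realType.
Local Notation C := R[i].
Local Notation D := 'M[C]_2.
Local Notation A := (fc_alg (spin_cstar R)).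
Local Notation tau := (@spin_antipode R).
Local Notation X := (spin_crossed_product R).
Implicit Types (q : join_pt R).

Definition unit_at q : circle_pt R := unit_pt (jp_unit q) (jp_tr q).

(** The map into the join starts with the values at the points [(m, 0)]. They lie
    in the group algebra because this holds for the coordinates, with coefficients
    independent of [m], and is preserved by the operations and by limits. *)
Section UnitSpan.

Definition spanned (f : circle_pt R -> D) := bounded_fct f /\
  exists c d : C, forall q, f (unit_at q) = unit_span (jp_m q) c d.

Lemma spanned_bounded f : spanned f -> bounded_fct f.
Proof. by case. Qed.

Lemma spanned_one : spanned 1.
Proof.
split; first exact: bounded_one.
by exists 1, 0 => q; rewrite /unit_span scale1r scale0r addr0.
Qed.

Lemma spanned_lin (e : C) f g : spanned f -> spanned g -> spanned (e *: f + g).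
Proof.
move=> [bf [c [d fE]]] [bg [c' [d' gE]]]; split; first exact: bounded_lin.
exists (e * c + c'), (e * d + d') => q.
by rewrite -unit_spanD -fE -gE.
Qed.

Lemma spanned_mul f g : spanned f -> spanned g -> spanned (f * g).
Proof.
move=> [bf [c [d fE]]] [bg [c' [d' gE]]]; split; first exact: bounded_mul.
exists (c * c' + d * d'), (c * d' + d * c') => q.
by rewrite -(unit_spanM (jp_mK q)) -fE -gE.
Qed.

Lemma spanned_star f : spanned f -> spanned (star f).
Proof.
move=> [bf [c [d fE]]]; split; first exact: bounded_star.
exists (Num.conj c), (Num.conj d) => q.
by rewrite -(unit_span_star (star_jp_m q)) -fE.
Qed.

Let half_trace (z : D) : C := 2^-1 * \tr z.

Let half_trace_le z : Normc.normc (half_trace z) <= cnorm z.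
Proof.
rewrite /half_trace Normc.normcM normc2V ler_pdivrMl // mulr_natl mulr2n /mxtrace sum2.
apply: le_trans (le_normcD _ _) _.
by rewrite lerD ?normc_entry_le.
Qed.

Let half_traceB z z' : half_trace (z - z') = half_trace z - half_trace z'.
Proof. by rewrite /half_trace raddfB mulrBr. Qed.

Let half_trace_span q c d : half_trace (unit_span (jp_m q) c d) = c.
Proof.
rewrite /half_trace /unit_span raddfD /= !mxtraceZ jp_tr mulr0 addr0.
by rewrite (mxtrace1 C 2) mulrCA mulVf ?mulr1 // pnatr_eq0.
Qed.

(** The coefficients are recovered by traces at one point, hence converge. *)
Lemma spanned_lim f :
  (forall e, 0 < e -> exists2 g, spanned g & forall t, cnorm (f t - g t) <= e) ->
  spanned f.
Proof.
move=> happrox; split.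
  by apply: bounded_lim => e /happrox[g [bg _] fg]; exists g.
pose q0 : join_pt R := point.
pose c := half_trace (f (unit_at q0)).
pose d := half_trace (f (unit_at q0) * jp_m q0).
exists c, d => q; apply: cnorm_approx_eq => e e0.
have [g [_ [c' [d' gE]]] fg] := happrox _ (divr_gt0 e0 (ltr0Sn _ 2)).
have cc' : Normc.normc (c' - c) <= e / 3.
  rewrite -{1}(half_trace_span q0 c' d') -gE -half_traceB.
  by apply: le_trans (half_trace_le _) _; rewrite cnormBC.
have dd' : Normc.normc (d' - d) <= e / 3.
  have -> : d' = half_trace (g (unit_at q0) * jp_m q0).
    rewrite gE -[LHS](half_trace_span q0 d' c') /unit_span mulrDl -!scalerAl jp_mK mul1r.
    by rewrite addrC.
  rewrite -half_traceB -mulrBl; apply: le_trans (half_trace_le _) _.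
  by apply: le_trans (cnormM _ _) _; rewrite cnorm_jp_m mulr1 cnormBC.
apply: le_trans (cnorm_triangle _ (g (unit_at q)) _) _.
have -> : e = e / 3 + (e / 3 + e / 3) by field.
apply: lerD => //; rewrite gE /unit_span opprD addrACA -!scalerBl.
apply: le_trans (cnormD _ _) _.
by rewrite !cnormZ cnorm1 cnorm_jp_m !mulr1 lerD.
Qed.

Definition spanned_cstar : fun_cstar (circle_pt R) D := FunCStar spanned_bounded
  spanned_one spanned_lin spanned_mul spanned_star spanned_lim.

Lemma spin_spanned (a : A) :
  exists c d : C, forall q, fc_val a (unit_at q) = unit_span (jp_m q) c d.
Proof.
have : spanned_cstar (fc_val a); last by case.
apply: (fc_inP a) => g gc; split; first exact: coords_bounded gc.
case: gc => ->.
  by exists 0, 1 => q; rewrite /unit_span scale0r scale1r add0r.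
by exists 0, 0 => q; rewrite /unit_span !scale0r addr0.
Qed.

End UnitSpan.

Let th : unit_interval R -> R := path_angle (pi / 2) 0.

Definition join_path (t : unit_interval R) : join_pt R -> circle_pt R :=
  join_map (cos2Dsin2 (th t)).

Lemma join_path_gen g : coords g ->
  exists f : unit_interval R -> fc_alg (join_cstar R), transport_along join_path g f.
Proof.
case=> ->.
  exists (fun t => (sin (th t))%:C *: spin_inj (spin_x R) + (cos (th t))%:C *: spin_mu R).
  by split=> //; apply: path_add; [exact: path_sin|exact: path_cos].
exists (fun t => (sin (th t))%:C *: spin_inj (spin_y R)).
by split=> //; exact: path_sin.
Qed.

Definition spin_join (a : A) (t : unit_interval R) : X := transport join_path_gen t a.

Lemma spin_joinE a t q : fc_val (spin_join a t) q = fc_val a (join_path t q).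
Proof. exact: transportE. Qed.

Lemma spin_join_hom : star_hom spin_join.
Proof.
have h t := transport_hom (@coords_bounded R) join_path_gen t.
split=> [c a b||a].
- by apply/funext => t; have [l _ _] := h t; exact: l.
- split=> [|a b]; apply/funext => t; have [_ [h1 hM] _] := h t; first exact: h1.
  exact: hM.
- by apply/funext => t; have [_ _ s] := h t; exact: s.
Qed.

Lemma spin_join_in a : twisted_join (spin_join a).
Proof.
split.
- exact: transport_continuous.
- have [c [d hcd]] := spin_spanned a.
  exists (fun j => if j == 0 then c else d).
  have -> : \sum_(j < 2) (if j == 0 then c else d) *: cp_mu X ^+ j =
      c *: 1 + d *: spin_mu R by rewrite sum2 expr0 expr1.
  apply: fc_ext => q; rewrite spin_joinE.
  have -> : join_path (itv0 R) q = unit_at q.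
    apply: circle_pt_eq; rewrite /= /th path_angle0 sin0 rmorph0 !scale0r //.
    by rewrite cos0 rmorph1 scale1r add0r.
  by rewrite hcd.
- exists a => //; apply: fc_ext => q; rewrite spin_joinE.
  congr (fc_val a _); apply: circle_pt_eq;
    rewrite /= /th path_angle1 addr0 sin_pihalf rmorph1 scale1r //.
  by rewrite cos_pihalf rmorph0 scale0r addr0.
Qed.

(** The twisted automorphism of the crossed product is the substitution
    [(u, v, m) |-> (- u, - v, - m)]. Equivariance follows, as this substitution
    changes the sign of [(s u + c m, s v)]. *)
Lemma spin_twisted_autE (F : X) q :
  fc_val (twisted_aut (iter_action tau) F) q = fc_val (F : fc_alg _) (neg_join_pt q).
Proof.
rewrite (cp_pairE F) twisted_aut_pair.
move: (cp_coef F 0) (cp_coef F 1) => a0 a1.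
have lhs : fc_val (spin_inj (tau a0) + -1 *: (spin_inj (tau a1) * spin_mu R)) q =
    fc_val a0 (neg_pt (jp_base q)) - fc_val a1 (neg_pt (jp_base q)) * jp_m q.
  by rewrite fc_evalD fc_evalZ fc_evalM scaleN1r /= !spin_antipodeE.
have rhs : fc_val (spin_inj a0 + spin_inj a1 * spin_mu R) (neg_join_pt q) =
    fc_val a0 (neg_pt (jp_base q)) - fc_val a1 (neg_pt (jp_base q)) * jp_m q.
  by rewrite combination_pair /= mulrN.
exact: etrans lhs (esym rhs).
Qed.

Lemma spin_has_join : has_equivariant_hom_to_join (iter_action tau) X.
Proof.
exists spin_join; split; [exact: spin_join_hom|exact: spin_join_in|].
apply: equivariant_iter => a t; apply: fc_ext => q.
rewrite spin_twisted_autE !spin_joinE spin_antipodeE; congr (fc_val a _).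
by apply: circle_pt_eq; rewrite /= ?opprD !scalerN.
Qed.

End SpinJoin.

Theorem theorem3p3 (R : realType) :
  (forall (A : cstarAlgType R) (x y : A), universal_circle x y ->
    exists alpha : 'Z_2 -> A -> A,
      [/\ is_action alpha, alpha 1 x = - x & alpha 1 y = - y] /\
      let beta := alpha in
      [/\ forall X : crossed_product beta, has_equivariant_hom_to_join alpha X,
          free_action alpha & connected_to_id (beta 1)]) /\
  ~ (forall (k : nat) (A : cstarAlgType R) (alpha beta : 'Z_k -> A -> A),
      (2 <= k)%N -> is_action alpha -> is_action beta ->
      commuting alpha beta -> free_action alpha ->
      (forall g, connected_to_id (beta g)) ->
      forall X : crossed_product beta, ~ has_equivariant_hom_to_join alpha X).
Proof.
split=> [A x y U|none].
  exists (iter_action (antipode U)); split.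
    split; [|exact: antipode_x|exact: antipode_y].
    exact: iter_action_is_action (antipode_hom U) (antipodeK U).
  split; [exact: universal_join| |exact: antipode_connected].
  exact (iter_action_free (antipode_hom U) U.1 (antipode_x U) (antipode_y U)).
(* The counterexample has [k = 2] and [alpha = beta]. *)
have hom := @spin_antipode_hom R; have invol := @spin_antipodeK R.
apply: (none 2%N _ _ _ _ _ _ _ _ _ (spin_crossed_product R) (spin_has_join R)) => //.
- exact: iter_action_is_action.
- exact: iter_action_is_action.
- by move=> g h a; rewrite /= /iter_action -!iterD addnC.
- exact (iter_action_free hom (spin_relations R) (@spin_antipode_x R) (@spin_antipode_y R)).
- move=> g; have [->|->] := I2P g; last exact: spin_antipode_connected.
  exact: connected_to_id_id.
Qed.
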